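(* Let $\kappa\in\mathbb{C}^*$, $\epsilon\in\{+,-\}$, $n\in\{1,\ldots,N\}$, and let ${}_{\mathsf n}\langle P,\kappa,\epsilon|$ and $|Q,\kappa,\epsilon\rangle_{\mathsf n}$ be left and right eigenstates of the twisted antiperiodic transfer matrix $\mathcal T_K(\lambda)$, $K=\mathrm{diag}(\kappa,\kappa^{-1})\cdot\sigma^x$, with respective eigenvalues $\epsilon\tau_P$ and $\epsilon\tau_Q$. Let $p_1,\ldots,p_N$ and $q_1,\ldots,q_N$ be the roots of $P$ and $Q$. Then the form factor of the local operator $\sigma_n^z$ is $${}_{\mathsf n}\langle P,\kappa,\epsilon|\,\sigma_n^z\,|Q,\kappa,\epsilon\rangle_{\mathsf n}=-\prod_{k=1}^n\frac{\tau_P(\xi_k)}{\tau_Q(\xi_k)}\ \frac{\det_N\left[\mathcal S(\mathbf q\,|\,\mathbf p)-\mathcal P^{(z)}(\mathbf q\,|\,\mathbf p,\xi_n)\right]}{\det_{1\le j,k\le N}\left[\coth\left(\frac{p_k-q_j-\eta}{2}\right)\right]},$$ where, for $1\le j,k\le N$, $$[\mathcal S(\mathbf q\,|\,\mathbf p)]_{j,k}=\coth\left(\frac{p_k-q_j-\eta}{2}\right)+\mathfrak a_Q(p_k)\coth\left(\frac{p_k-q_j}{2}\right)-2\,\frac{d(p_k)}{a(q_j)}\frac{Q(q_j+\eta)P(q_j+i\pi)}{Q(p_k-\eta)P(p_k+i\pi)}\frac{1}{\sinh(p_k-q_j)},$$ and $\mathcal P^{(z)}(\mathbf q\,|\,\mathbf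 p,\xi_n)$ is the rank $1$ matrix with elements $$\left[\mathcal P^{(z)}(\mathbf q\,|\,\mathbf p,\xi_n)\right]_{j,k}=\frac{P(p_k-\eta)}{Q(p_k-\eta)}\left[\frac{Q(\xi_n-\eta)}{P(\xi_n-\eta)}\coth\left(\frac{\xi_n-q_j-\eta}{2}\right)+\frac{Q(\xi_n-\eta+i\pi)}{P(\xi_n-\eta+i\pi)}\coth\left(\frac{\xi_n+i\pi-q_j-\eta}{2}\right)\right].$$ Alternatively, for arbitrary parameters $z_1,\ldots,z_N$, $${}_{\mathsf n}\langle P,\kappa,\epsilon|\,\sigma_n^z\,|Q,\kappa,\epsilon\rangle_{\mathsf n}=-\frac{\prod_{i,j=1}^N\left[\sinh(z_i-\xi_j)\sinh(\xi_j-p_i)\right]}{e^{\sum_\ell\xi_\ell}\prod_{j=1}^N\tau_Q(\xi_j)\prod_{i<j}\left[\sinh(z_j-z_i)\sinh(p_i-p_j)\right]}\ \prod_{k=1}^n\frac{\tau_P(\xi_k)}{\tau_Q(\xi_k)}\ \det_N\left[\mathcal S_{\tau_Q,\tau_P}(\mathbf z\,|\,\mathbf p)+\mathcal P^{(z)}_{\tau_Q}(\mathbf z\,|\,\mathbf p,\xi_n)\right],$$ where, with $\hat\tau_P(\lambda)=e^\lambda\tau_P(\lambda)/d(\lambda)$ and $\hat\tau_Q(\lambda)=e^\lambda\tau_Q(\lambda)/d(\lambda)$, $$[\mathcal S_{\tau_Q,\tau_P}(\mathbf z\,|\,\mathbf p)]_{i,k}=\frac{\hat\tau_Q(z_i)-\hat\tau_Q(p_k)}{\sinh(z_i-p_k)}-\frac{\hat\tau_P(z_i)-\hat\tau_P(p_k+\eta)}{\sinh(z_i-p_k-\eta)},$$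 and $\mathcal P^{(z)}_{\tau_Q}(\mathbf z\,|\,\mathbf p,\xi_n)$ is the rank $1$ matrix with elements $$\left[\mathcal P^{(z)}_{\tau_Q}(\mathbf z\,|\,\mathbf p,\xi_n)\right]_{i,\ell}=\frac{e^{\xi_n}\,\tau_Q(\xi_n)}{d(p_\ell)\,\sinh(z_i-\xi_n)}\,\frac{P(p_\ell-\eta)}{P(\xi_n-\eta)}\,\frac{P(p_\ell+i\pi)}{P(\xi_n+i\pi)}.$$
   Context: $N\ge 1$ is an integer; $\eta\in\mathbb{C}$ is not commensurate with $i\pi$; $\xi_1,\ldots,\xi_N\in\mathbb{C}$ are such that the sets $\Xi_i=\{\xi_i+k\eta+ik'\pi\mid k\in\{0,-1\},\,k'\in\mathbb{Z}\}$ satisfy $\Xi_i\cap\Xi_j=\emptyset$ for $i\ne j$. Set $a(\lambda)=\prod_{n=1}^N\sinh(\lambda-\xi_n+\eta)$, $d(\lambda)=\prod_{n=1}^N\sinh(\lambda-\xi_n)$, $\mathfrak a_Q(\lambda)=\frac{d(\lambda)}{a(\lambda)}\frac{Q(\lambda+\eta)}{Q(\lambda-\eta)}$, $\xi_n^{(h)}=\xi_n-h\eta$ for $h\in\{0,1\}$, $V(x_1,\ldots,x_N)=\prod_{i<j}\sinh(x_j-x_i)$. The sign $\epsilon$ is identified with $\pm1$ in formulas. Model: on $\mathcal H=\otimes_{n=1}^NV_n$, $V_n\simeq\mathbb{C}^2$, with auxiliary space $V_0\simeq\mathbb{C}^2$, the monodromy matrix is $T_0(\lambda)=R_{0,N}(\lambda-\xi_N)\cdots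 R_{0,1}(\lambda-\xi_1)=\begin{pmatrix}A(\lambda)&B(\lambda)\\C(\lambda)&D(\lambda)\end{pmatrix}_{[0]}$, with $R(\lambda)=\begin{pmatrix}\sinh(\lambda+\eta)&0&0&0\\0&\sinh\lambda&\sinh\eta&0\\0&\sinh\eta&\sinh\lambda&0\\0&0&0&\sinh(\lambda+\eta)\end{pmatrix}$. The transfer matrix is $\mathcal T_K(\lambda)=\mathrm{tr}_0[K_0T_0(\lambda)]=\kappa^{-1}B(\lambda)+\kappa\,C(\lambda)$. $\sigma_n^z$ is the Pauli matrix $\sigma^z$ acting on $V_n$. SoV bases: there exist a basis $\{\langle\mathbf h|\}$ of $\mathcal H^*$ and a basis $\{|\mathbf h\rangle\}$ of $\mathcal H$, $\mathbf h\in\{0,1\}^N$, such that $\langle\mathbf h|\mathbf k\rangle=\delta_{\mathbf h,\mathbf k}/V(\xi_1^{(h_1)},\ldots,\xi_N^{(h_N)})$ and $$\langle\mathbf h|D(\lambda)=\prod_n\sinh(\lambda-\xi_n^{(h_n)})\langle\mathbf h|,\quad \langle\mathbf h|C(\lambda)=\sum_{a=1}^N\prod_{b\ne a}\frac{\sinh(\lambda-\xi_b^{(h_b)})}{\sinh(\xi_a^{(h_a)}-\xi_b^{(h_b)})}\delta_{h_a,0}\,d(\xi_a^{(1)})\langle\mathrm T_a^+\mathbf h|,$$ $$\langle\mathbf h|B(\lambda)=-\sum_{a=1}^N\prod_{b\ne a}\frac{\sinh(\lambda-\xi_b^{(h_b)})}{\sinh(\xi_a^{(h_a)}-\xi_b^{(h_b)})}\delta_{h_a,1}\,a(\xi_a^{(0)})\langle\mathrm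 T_a^-\mathbf h|,$$ $$D(\lambda)|\mathbf h\rangle=\prod_n\sinh(\lambda-\xi_n^{(h_n)})|\mathbf h\rangle,\quad C(\lambda)|\mathbf h\rangle=\sum_{a=1}^N\prod_{b\ne a}\frac{\sinh(\lambda-\xi_b^{(h_b)})}{\sinh(\xi_a^{(h_a)}-\xi_b^{(h_b)})}\delta_{h_a,1}\,d(\xi_a^{(1)})|\mathrm T_a^-\mathbf h\rangle,$$ $$B(\lambda)|\mathbf h\rangle=-\sum_{a=1}^N\prod_{b\ne a}\frac{\sinh(\lambda-\xi_b^{(h_b)})}{\sinh(\xi_a^{(h_a)}-\xi_b^{(h_b)})}\delta_{h_a,0}\,a(\xi_a^{(0)})|\mathrm T_a^+\mathbf h\rangle,$$ where $\mathrm T_a^\pm\mathbf h$ is $\mathbf h$ with $h_a$ replaced by $h_a\pm1$. Separate states: $${}_{\mathsf n}\langle P,\kappa,\epsilon|=\sum_{\mathbf h}\prod_{m=1}^N\left(\frac{\epsilon}{\kappa}\frac{P(\xi_m)}{P(\xi_m-\eta)}\right)^{1-h_m}V(\xi_1^{(h_1)},\ldots,\xi_N^{(h_N)})\langle\mathbf h|,$$ $$|Q,\kappa,\epsilon\rangle_{\mathsf n}=\sum_{\mathbf h}\prod_{m=1}^N\left(\epsilon\kappa\frac{Q(\xi_m)}{Q(\xi_m-\eta)}\right)^{1-h_m}\frac{V(\xi_1^{(1-h_1)},\ldots,\xi_N^{(1-h_N)})}{V(\xi_1,\ldots,\xi_N)}|\mathbf h\rangle.$$ Known characterization of eigenstates: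 ${}_{\mathsf n}\langle P,\kappa,\epsilon|$ is an eigenstate with eigenvalue $\epsilon\tau_P$ means that $P(\lambda)=\prod_{j=1}^N\sinh(\frac{\lambda-p_j}2)$, $(P(\xi_j),P(\xi_j+i\pi))\neq(0,0)$ for all $j$, $\tau_P$ is entire with $\tau_P(\lambda+i\pi)=(-1)^{N-1}\tau_P(\lambda)$, and $\tau_P(\lambda)P(\lambda)=-a(\lambda)P(\lambda-\eta)+d(\lambda)P(\lambda+\eta)$; similarly for $Q(\lambda)=\prod_{j=1}^N\sinh(\frac{\lambda-q_j}2)$ and $\tau_Q$. The spectrum of $\mathcal T_K$ is simple. Consequently $P(\xi_m-\eta)/P(\xi_m)=-P(\xi_m-\eta+i\pi)/P(\xi_m+i\pi)$ for all $m$, and similarly for $Q$. The identities are understood for parameters such that no denominator (including determinants in denominators) vanishes. *)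

(* Defs.v *)
From HB Require Import structures.
From mathcomp Require Import all_boot all_order all_algebra.
From mathcomp Require Import all_classical all_reals all_analysis.
From mathcomp Require Import complex.

Set Implicit Arguments.
Unset Strict Implicit.
Unset Printing Implicit Defensive.

Import Order.TTheory GRing.Theory Num.Theory.
Import numFieldNormedType.Exports.

Local Open Scope classical_set_scope.
Local Open Scope complex_scope.
Local Open Scope ring_scope.

Section Hyperbolic.
Context {R : realType}.
Implicit Types (z : R[i]).

Definition cexp z : R[i] :=
  (expR (complex.Re z))%:C * (cos (complex.Im z) +i* sin (complex.Im z)).
Definition csinh z : R[i] := (cexp z - cexp (- z)) / 2.
Definition ccosh z : R[i] := (cexp z + cexp (- z)) / 2.
Definition ccoth z : R[i] := ccosh z / csinh z.

Definition ipi : R[i] := 0 +i* pi.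

Definition entire (f : R[i] -> R[i]) : Prop :=
  forall z, derivable (f : R[i]^o -> R[i]^o) z 1.

Definition commensurate (x y : R[i]) : Prop := exists r : rat, x = ratr r * y.

End Hyperbolic.

Arguments ipi {R}.

Section Operators.
Context {C : fieldType}.

(* Operators on the space with basis I (a finite type), as square matrices
   whose rows and columns are listed along the enumeration of I. *)
Definition mkop (I : finType) (f : I -> I -> C) : 'M[C]_#|I| :=
  \matrix_(x, y) f (enum_val x) (enum_val y).
Definition entry (I : finType) (M : 'M[C]_#|I|) (s t : I) : C :=
  M (enum_rank s) (enum_rank t).

End Operators.

(* Both the canonical basis of the quantum space and the SoV labels h. *)
Definition config (N : nat) : finType := {ffun 'I_N -> 'I_2}.
Definition aux_config (N : nat) : finType := ('I_2 * config N)%type.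

Section Model.
Context {R : realType} {N : nat}.
Local Notation C := (R[i]).
Variables (eta : C) (xi : 'I_N -> C).
Implicit Types (lam : C) (h : config N).

Definition Xi (j : 'I_N) : set C :=
  [set x | exists k k' : int, (k = 0 \/ k = -1) /\
             x = xi j + k%:~R * eta + k'%:~R * ipi].

Definition a_fun lam : C := \prod_(m < N) csinh (lam - xi m + eta).
Definition d_fun lam : C := \prod_(m < N) csinh (lam - xi m).

Definition xi_h (h : nat) (m : 'I_N) : C := xi m - h%:R * eta.

Definition vdm (x : 'I_N -> C) : C :=
  \prod_(i < N) \prod_(j < N | (i < j)%N) csinh (x j - x i).

(* Entry of the six-vertex R-matrix in row (i, s) and column (j, t); the first
   index of each pair belongs to the auxiliary space. *)
Definition R_entry lam (i s j t : 'I_2) : C :=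
  if (i == j) && (s == t) then
    if i == s then csinh (lam + eta) else csinh lam
  else if (i == t) && (s == j) then csinh eta else 0.

Definition R0 (m : 'I_N) lam : 'M[C]_#|aux_config N| :=
  mkop (fun x y : aux_config N =>
    if [forall l, (l != m) ==> (x.2 l == y.2 l)]
    then R_entry lam x.1 (x.2 m) y.1 (y.2 m) else 0).

(* The factor with the largest index stands on the left. *)
Definition monodromy lam : 'M[C]_#|aux_config N| :=
  \big[mulmx/1%:M]_(m <- rev (enum 'I_N)) R0 m (lam - xi m).

Definition aux_block (i j : 'I_2) (M : 'M[C]_#|aux_config N|) :
    'M[C]_#|config N| :=
  mkop (fun s t : config N => @entry _ (aux_config N) M (i, s) (j, t)).

Definition opA lam := aux_block ord0 ord0 (monodromy lam).
Definition opB lam := aux_block ord0 ord_max (monodromy lam).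
Definition opC lam := aux_block ord_max ord0 (monodromy lam).
Definition opD lam := aux_block ord_max ord_max (monodromy lam).

Definition sigma_x : 'M[C]_2 := \matrix_(i, j) (i != j)%:R.
Definition twist (kappa : C) : 'M[C]_2 :=
  diag_mx (\row_(i < 2) if i == ord0 then kappa else kappa^-1) *m sigma_x.
Definition aux_op (K : 'M[C]_2) : 'M[C]_#|aux_config N| :=
  mkop (fun x y : aux_config N => K x.1 y.1 * (x.2 == y.2)%:R).
Definition aux_tr (M : 'M[C]_#|aux_config N|) : 'M[C]_#|config N| :=
  \sum_i aux_block i i M.
Definition transfer (K : 'M[C]_2) lam : 'M[C]_#|config N| :=
  aux_tr (aux_op K *m monodromy lam).

Definition sigma_z (n : 'I_N) : 'M[C]_#|config N| :=
  mkop (fun s t : config N => (s == t)%:R * (-1) ^+ s n).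

(* The linear form v applied to the vector w. *)
Definition pairing (v : 'rV[C]_#|config N|) (w : 'cV[C]_#|config N|) : C :=
  (v *m w) 0 0.

(* Only used when h a = 0 (resp. h a = 1). *)
Definition raise (a : 'I_N) h : config N :=
  [ffun b => if b == a then inord (h b).+1 else h b].
Definition lower (a : 'I_N) h : config N :=
  [ffun b => if b == a then inord (h b).-1 else h b].

Definition sov_coef lam h (a : 'I_N) : C :=
  \prod_(b < N | b != a)
     (csinh (lam - xi_h (h b) b) / csinh (xi_h (h a) a - xi_h (h b) b)).

Record SoV_bases (bra : config N -> 'rV[C]_#|config N|)
                 (ket : config N -> 'cV[C]_#|config N|) : Prop := {
  bra_basis : basis_of fullv [seq bra h | h : config N];
  ket_basis : basis_of fullv [seq ket h | h : config N];
  bra_ket : forall h k : config N,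
    pairing (bra h) (ket k) = (h == k)%:R / vdm (fun m => xi_h (h m) m);
  bra_D : forall h lam,
    bra h *m opD lam = (\prod_(m < N) csinh (lam - xi_h (h m) m)) *: bra h;
  bra_C : forall h lam,
    bra h *m opC lam =
      \sum_(a < N) (sov_coef lam h a * (h a == 0%N :> nat)%:R
                      * d_fun (xi_h 1 a)) *: bra (raise a h);
  bra_B : forall h lam,
    bra h *m opB lam =
      - \sum_(a < N) (sov_coef lam h a * (h a == 1%N :> nat)%:R
                        * a_fun (xi_h 0 a)) *: bra (lower a h);
  ket_D : forall h lam,
    opD lam *m ket h = (\prod_(m < N) csinh (lam - xi_h (h m) m)) *: ket h;
  ket_C : forall h lam,
    opC lam *m ket h =
      \sum_(a < N) (sov_coef lam h a * (h a == 1%N :> nat)%:R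
                      * d_fun (xi_h 1 a)) *: ket (lower a h);
  ket_B : forall h lam,
    opB lam *m ket h =
      - \sum_(a < N) (sov_coef lam h a * (h a == 0%N :> nat)%:R
                        * a_fun (xi_h 0 a)) *: ket (raise a h)
}.

(* The function P (or Q) with roots p_1, ..., p_N. *)
Definition tpoly (p : 'I_N -> C) lam : C := \prod_(j < N) csinh ((lam - p j) / 2).

Definition left_sep (bra : config N -> 'rV[C]_#|config N|)
    (P : C -> C) (kappa eps : C) : 'rV[C]_#|config N| :=
  \sum_(h : config N)
    ((\prod_(m < N) (eps / kappa * (P (xi m) / P (xi m - eta))) ^+ (1 - h m))
       * vdm (fun m => xi_h (h m) m)) *: bra h.

Definition right_sep (ket : config N -> 'cV[C]_#|config N|)
    (Q : C -> C) (kappa eps : C) : 'cV[C]_#|config N| :=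
  \sum_(h : config N)
    ((\prod_(m < N) (eps * kappa * (Q (xi m) / Q (xi m - eta))) ^+ (1 - h m))
       * (vdm (fun m => xi_h (1 - h m) m) / vdm xi)) *: ket h.

Definition left_eigen (T : C -> 'M[C]_#|config N|) (v : 'rV[C]_#|config N|)
    (t : C -> C) : Prop :=
  v != 0 /\ forall lam, v *m T lam = t lam *: v.
Definition right_eigen (T : C -> 'M[C]_#|config N|) (v : 'cV[C]_#|config N|)
    (t : C -> C) : Prop :=
  v != 0 /\ forall lam, T lam *m v = t lam *: v.

Record TQ_solution (P tau : C -> C) : Prop := {
  TQ_nonvanishing : forall j, (P (xi j), P (xi j + ipi)) != (0, 0);
  TQ_entire : entire tau;
  TQ_periodic : forall lam, tau (lam + ipi) = (-1) ^+ (N - 1) * tau lam;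
  TQ_eq : forall lam,
    tau lam * P lam = - (a_fun lam * P (lam - eta)) + d_fun lam * P (lam + eta)
}.

Definition left_eigenstate bra (p : 'I_N -> C) (tau : C -> C)
    (kappa eps : C) : Prop :=
  TQ_solution (tpoly p) tau /\
  left_eigen (transfer (twist kappa)) (left_sep bra (tpoly p) kappa eps)
             (fun lam => eps * tau lam).
Definition right_eigenstate ket (q : 'I_N -> C) (tau : C -> C)
    (kappa eps : C) : Prop :=
  TQ_solution (tpoly q) tau /\
  right_eigen (transfer (twist kappa)) (right_sep ket (tpoly q) kappa eps)
              (fun lam => eps * tau lam).

Section Determinants.
Variables (p q z : 'I_N -> C) (tauP tauQ : C -> C) (n : 'I_N).
Let P := tpoly p.
Let Q := tpoly q.

Definition frak_a (F : C -> C) lam : C :=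
  d_fun lam / a_fun lam * (F (lam + eta) / F (lam - eta)).

Definition coth_mx : 'M[C]_N := \matrix_(j, k) ccoth ((p k - q j - eta) / 2).

Definition S_mx : 'M[C]_N := \matrix_(j, k)
  (ccoth ((p k - q j - eta) / 2) + frak_a Q (p k) * ccoth ((p k - q j) / 2)
   - 2 * (d_fun (p k) / a_fun (q j))
       * ((Q (q j + eta) * P (q j + ipi)) / (Q (p k - eta) * P (p k + ipi)))
       * (csinh (p k - q j))^-1).

Definition Pz_mx : 'M[C]_N := \matrix_(j, k)
  (P (p k - eta) / Q (p k - eta)
   * (Q (xi n - eta) / P (xi n - eta) * ccoth ((xi n - q j - eta) / 2)
      + Q (xi n - eta + ipi) / P (xi n - eta + ipi)
          * ccoth ((xi n + ipi - q j - eta) / 2))).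

Definition hat (tau : C -> C) lam : C := cexp lam * tau lam / d_fun lam.

Definition S_tau_mx : 'M[C]_N := \matrix_(i, k)
  ((hat tauQ (z i) - hat tauQ (p k)) / csinh (z i - p k)
   - (hat tauP (z i) - hat tauP (p k + eta)) / csinh (z i - p k - eta)).

Definition Pz_tau_mx : 'M[C]_N := \matrix_(i, l)
  (cexp (xi n) * tauQ (xi n) / (d_fun (p l) * csinh (z i - xi n))
   * (P (p l - eta) / P (xi n - eta)) * (P (p l + ipi) / P (xi n + ipi))).

(* Nonvanishing of the denominators of the first representation, of its
   matrices S_mx and Pz_mx included. *)
Record regular_pq : Prop := {
  pq_tauQ : forall k : 'I_N, (k <= n)%N -> tauQ (xi k) != 0;
  pq_det : \det coth_mx != 0;
  pq_coth_eta : forall j k, csinh ((p k - q j - eta) / 2) != 0;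
  pq_coth : forall j k, csinh ((p k - q j) / 2) != 0;
  pq_sinh : forall j k, csinh (p k - q j) != 0;
  pq_a_p : forall k, a_fun (p k) != 0;
  pq_a_q : forall j, a_fun (q j) != 0;
  pq_Q : forall k, Q (p k - eta) != 0;
  pq_P_ipi : forall k, P (p k + ipi) != 0;
  pq_P_xi : P (xi n - eta) != 0;
  pq_P_xi_ipi : P (xi n - eta + ipi) != 0;
  pq_coth_xi : forall j, csinh ((xi n - q j - eta) / 2) != 0;
  pq_coth_xi_ipi : forall j, csinh ((xi n + ipi - q j - eta) / 2) != 0
}.

(* Same for the second representation; this also constrains the otherwise
   arbitrary parameters z. *)
Record regular_z : Prop := {
  z_tauQ : forall j, tauQ (xi j) != 0;
  z_distinct : forall i j : 'I_N, (i < j)%N -> csinh (z j - z i) != 0;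
  z_p_distinct : forall i j : 'I_N, (i < j)%N -> csinh (p i - p j) != 0;
  z_d_z : forall i, d_fun (z i) != 0;
  z_d_p : forall k, d_fun (p k) != 0;
  z_d_p_eta : forall k, d_fun (p k + eta) != 0;
  z_sinh_p : forall i k, csinh (z i - p k) != 0;
  z_sinh_p_eta : forall i k, csinh (z i - p k - eta) != 0;
  z_sinh_xi : forall i, csinh (z i - xi n) != 0;
  z_P_xi : P (xi n - eta) != 0;
  z_P_xi_ipi : P (xi n + ipi) != 0
}.

End Determinants.
End Model.

(* Main.v *)
(* With G_m = T(xi_1) ... T(xi_m), the local operator satisfies
   sigma_n G_n = G_(n-1) X(xi_n), X = kappa C - kappa^-1 B = T - 2 kappa^-1 B, so
   between eigenstates the form factor reduces to <P|Q> and <P|B(xi_n)|Q>.  In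
   the SoV basis <P|Q> is a sum of Vandermonde products, i.e. the determinant
   whose m-th row is u |-> u(xi_m) + f_m u(xi_m - eta) on trigonometric
   polynomials u of degree N - 1, and the matrix element of B replaces the n-th
   row by a combination of the evaluations at all xi_m.  On the basis
   u_k(x) = prod_(l <> k) sinh(x - p_l) the TQ equation turns the m-th row into
   tau_Q(xi_m) / sinh(xi_m - p_k) - tau_P(xi_m) / sinh(xi_m - p_k - eta), and
   Lagrange interpolation at the xi_m gives the extra rank-one row in closed
   form.  The two representations arise by multiplying on the left by Cauchy-like
   matrices in z or in q, the sums over the xi_m being partial fractions. *)

Require Import Defs.
From mathcomp Require Import all_boot all_order all_algebra.
From mathcomp Require Import all_classical all_reals all_analysis.
From mathcomp Require Import complex.
From mathcomp Require Import ring lra zify.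

Set Implicit Arguments.
Unset Strict Implicit.
Unset Printing Implicit Defensive.

Import Order.TTheory GRing.Theory Num.Theory.

Local Open Scope classical_set_scope.
Local Open Scope complex_scope.
Local Open Scope ring_scope.

(** * Hyperbolic functions *)

(** The main obstacle is a mismatch of periods: [P] and [Q] are products of sinh of half arguments,
    whereas the Vandermonde products see an argument only modulo [i pi], up to sign. The bridge is
    the combination [W(x) - (-1)^N W(x + i pi)]: for [W] of degree [2N] in the half argument it is a
    trigonometric polynomial of degree [N - 1] in the full argument, and at a zero of [P] one of its
    two terms drops out. The shifts by [i pi] in the final matrices originate there.

    Scalars and constants that appear on both sides (products of R-matrix normalizations, the
    proportionality between a determinant of evaluations and a Vandermonde product) are kept as
    existential witnesses and never computed or inverted. Likewise the form factor is first obtained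
    multiplied by [det Y]. The nonvanishing of [det Y] is established separately for the two
    representations: from the coth determinant in one case, from an explicit Cauchy determinant in
    the other. *)

Lemma sin_eq0 (R : realType) (b : R) : sin b = 0 -> exists k : int, b = k%:~R * pi.
Proof.
(* Subtracting [floor (b / pi)] times [pi] brings [b] into [[0, pi)], where sin vanishes only at
   0. *)
move=> sb; exists (Num.floor (b / pi)); set k := Num.floor _.
have pi0 : 0 < pi :> R := pi_gt0 R.
have sink (j : int) (x : R) : sin x = 0 -> sin (x - j%:~R * pi) = 0.
  have sinn m (y : R) : sin y = 0 -> sin (y + m%:R * pi) = 0.
    move=> sy; elim: m => [|m ihm]; first by rewrite mul0r addr0.
    by rewrite -addn1 natrD mulrDl mul1r addrA sinDpi ihm oppr0.
  case: j => m sx; last by rewrite NegzE mulrNz mulNr opprK; apply: sinn.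
  rewrite -[_ - _]opprK sinN opprB addrC sinn ?oppr0 //.
  by rewrite sinN sx oppr0.
have /(sink k) sbk := sb; have /andP[lek ltk] := real_floor_itv (num_real (b / pi)).
move: lek ltk; rewrite ler_pdivlMr // ltr_pdivrMr // intrD mulrDl mul1r => lek ltk.
apply/eqP; rewrite -subr_eq0; apply/negP => /negP bk.
have : 0 < sin (b - k%:~R * pi).
  apply: sin_gt0_pi; rewrite lt_neqAle eq_sym bk /= subr_ge0 lek /=.
  by rewrite ltrBlDl.
by rewrite sbk ltxx.
Qed.

Section ComplexHyperbolic.
Context {R : realType}.
Implicit Types (x y z : R[i]).

Lemma cexpD x y : cexp (x + y) = cexp x * cexp y.
Proof.
case: x y => [a b] [c d]; rewrite /cexp /= expRD cosD sinD.
by apply/eqP; rewrite eq_complex; apply/andP; split; apply/eqP => /=; ring.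
Qed.

Lemma cexp0 : cexp (0 : R[i]) = 1.
Proof.
rewrite /cexp /= expR0 cos0 sin0.
by apply/eqP; rewrite eq_complex; apply/andP; split; apply/eqP => /=; ring.
Qed.

Lemma cexp_neq0 x : cexp x != 0.
Proof.
apply/eqP => x0; have := cexp0; rewrite -[X in cexp X](subrr x) cexpD x0 mul0r.
by move/esym/eqP; rewrite oner_eq0.
Qed.

Lemma cexpN x : cexp (- x) = (cexp x)^-1.
Proof. by apply: (mulfI (cexp_neq0 x)); rewrite mulfV ?cexp_neq0 // -cexpD subrr cexp0. Qed.

Lemma cexp_sum (I : Type) (s : seq I) (P : pred I) (F : I -> R[i]) :
  cexp (\sum_(i <- s | P i) F i) = \prod_(i <- s | P i) cexp (F i).
Proof. by elim/big_rec2: _ => [|i y z _ <-]; rewrite ?cexp0 ?cexpD. Qed.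

Lemma cexp_ipi : cexp (ipi : R[i]) = -1.
Proof.
rewrite /cexp /= expR0 cospi sinpi.
by apply/eqP; rewrite eq_complex; apply/andP; split; apply/eqP => /=; ring.
Qed.

Lemma half2 x : x = x / 2 + x / 2.
Proof. by field. Qed.

Lemma cexp_half_sqr x : cexp (x / 2) * cexp (x / 2) = cexp x.
Proof. by rewrite -cexpD -half2. Qed.

Definition cexpE := (cexpD, cexpN, cexp_ipi).

Lemma csinhE x : csinh x = (cexp x - (cexp x)^-1) / 2.
Proof. by rewrite /csinh cexpN. Qed.

Lemma ccoshE x : ccosh x = (cexp x + (cexp x)^-1) / 2.
Proof. by rewrite /ccosh cexpN. Qed.

Lemma csinhN x : csinh (- x) = - csinh x.
Proof. by rewrite /csinh opprK; ring. Qed.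

Lemma csinh_subC x y : csinh (x - y) = - csinh (y - x).
Proof. by rewrite -csinhN opprB. Qed.

Lemma csinh0 : csinh (0 : R[i]) = 0.
Proof. by rewrite /csinh oppr0 subrr mul0r. Qed.

Lemma csinh_ipi x : csinh (x + ipi) = - csinh x.
Proof.
rewrite !csinhE !cexpE mulrN1 invrN.
by have := cexp_neq0 x; move: (cexp x) => e e0; field.
Qed.

Lemma csinh_double x : csinh x = 2 * csinh (x / 2) * ccosh (x / 2).
Proof.
rewrite ccoshE !csinhE [in LHS](half2 x) cexpD.
by have := cexp_neq0 (x / 2); move: (cexp _) => e e0; field.
Qed.

Lemma csinh_half_ipi2 x : csinh ((x + 2 * ipi) / 2) = - csinh (x / 2).
Proof.
rewrite -csinh_ipi; congr csinh; by field.
Qed.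

Lemma ccosh_half_ipi x : ccosh ((x + ipi) / 2) = cexp (ipi / 2) * csinh (x / 2).
Proof.
rewrite ccoshE csinhE [(x + ipi) / 2]mulrDl cexpD.
have := cexp_half_sqr ipi; rewrite cexp_ipi.
have := cexp_neq0 (x / 2); have := cexp_neq0 (ipi / 2).
move: (cexp _) (cexp _) => f e e0 f0 e2.
(* Here [e] is [e^(i pi / 2)]; its square is -1, so its inverse is its opposite. *)
have -> : (f * e)^-1 = - (e / f).
  rewrite invfM mulrC -mulNr; congr (_ / _).
  by apply: (mulfI e0); rewrite divff // mulrN e2 opprK.
by ring.
Qed.

Lemma csinh_half_ipi x : csinh ((x + ipi) / 2) = cexp (ipi / 2) * ccosh (x / 2).
Proof.
rewrite ccoshE csinhE [(x + ipi) / 2]mulrDl cexpD.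
have := cexp_half_sqr ipi; rewrite cexp_ipi.
have := cexp_neq0 (x / 2); have := cexp_neq0 (ipi / 2).
move: (cexp _) (cexp _) => f e e0 f0 e2.
have -> : (f * e)^-1 = - (e / f).
  rewrite invfM mulrC -mulNr; congr (_ / _).
  by apply: (mulfI e0); rewrite divff // mulrN e2 opprK.
by ring.
Qed.

Lemma csinh_eq0 x : csinh x = 0 -> exists k : int, x = k%:~R * ipi.
Proof.
move/eqP; rewrite /csinh mulf_eq0 invr_eq0 pnatr_eq0 orbF subr_eq0.
case: x => a b; rewrite /cexp /= cosN sinN eq_complex /=.
rewrite !(mul0r, addr0, subr0) => /andP[/eqP cosab /eqP sinab].
have sb : sin b = 0.
  have : (expR a + expR (- a)) * sin b = 0 by rewrite mulrDl sinab; ring.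
  by move/eqP; rewrite mulf_eq0 gt_eqF ?addr_gt0 ?expR_gt0 //= => /eqP.
have cb : cos b != 0.
  apply/eqP => cb; have := cos2Dsin2 b.
  by rewrite cb sb !expr2 !mul0r addr0 => /esym/eqP; rewrite oner_eq0.
have /expR_inj a0 := mulIf cb cosab.
have [k ->] := sin_eq0 sb; exists k; rewrite /ipi.
have -> : a = 0 by lra.
have -> : (k%:~R : R[i]) = (k%:~R)%:C by rewrite (rmorph_int (real_complex R)).
by apply/eqP; rewrite eq_complex; apply/andP; split; apply/eqP => /=; ring.
Qed.

Lemma csinh_incommensurate x : ~ commensurate x ipi -> csinh x != 0.
Proof.
move=> h; apply/eqP => /csinh_eq0[k xk]; apply: h; exists k%:~R.
by rewrite ratr_int.
Qed.

End ComplexHyperbolic.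

(** * Trigonometric polynomials *)

Section ExpPoly.
Context {R : realType}.
Local Notation C := R[i].
Implicit Types (f g : C -> C) (s x y c : C).

(* Trigonometric polynomials [e^(- d s x) r(e^(2 s x))] with [deg r <= d]; only
   [s = 1] and [s = 1 / 2] are used. *)
Definition expoly s (d : nat) f : Prop :=
  exists2 r : {poly C}, (size r <= d.+1)%N &
    forall x, f x = (cexp (s * x) ^+ d)^-1 * r.[cexp (s * x) ^+ 2].

Lemma eq_expoly s d f g : f =1 g -> expoly s d f -> expoly s d g.
Proof. by move=> fg [r szr fE]; exists r => // x; rewrite -fg. Qed.

Lemma expoly_cst s c : expoly s 0 (fun _ => c).
Proof.
exists c%:P => [|x]; first by rewrite size_polyC; case: (c != 0).
by rewrite hornerC expr0 invr1 mul1r.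
Qed.

Lemma expolyM s d e f g :
  expoly s d f -> expoly s e g -> expoly s (d + e) (fun x => f x * g x).
Proof.
move=> [r szr fE] [t szt gE]; exists (r * t) => [|x].
  by rewrite (leq_trans (size_polyMleq _ _)) //; lia.
by rewrite fE gE hornerM exprD invfM mulrACA.
Qed.

Lemma expolyZ s d f c : expoly s d f -> expoly s d (fun x => c * f x).
Proof. by move/(expolyM (expoly_cst s c)). Qed.

Lemma expolyD s d f g :
  expoly s d f -> expoly s d g -> expoly s d (fun x => f x + g x).
Proof.
move=> [r szr fE] [t szt gE]; exists (r + t) => [|x].
  by rewrite (leq_trans (size_polyD _ _)) // geq_max szr.
by rewrite fE gE hornerD mulrDr.
Qed.

Lemma expoly0 s d : expoly s d (fun _ => 0).
Proof. by exists 0 => [|x]; rewrite ?size_poly0 // horner0 mulr0. Qed.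

Lemma expoly_sum s d (I : Type) (r : seq I) (P : pred I) (F : I -> C -> C) :
  (forall i, P i -> expoly s d (F i)) ->
  expoly s d (fun x => \sum_(i <- r | P i) F i x).
Proof.
move=> Fd; elim: r => [|i r ihr].
  by apply: eq_expoly (expoly0 s d) => x; rewrite big_nil.
have [Pi|Pi] := boolP (P i); last first.
  by apply: eq_expoly ihr => x; rewrite big_cons (negbTE Pi).
by apply: eq_expoly (expolyD (Fd i Pi) ihr) => x; rewrite big_cons Pi.
Qed.

Lemma expoly_prod s (I : Type) (r : seq I) (P : pred I) (e : I -> nat)
    (F : I -> C -> C) :
  (forall i, P i -> expoly s (e i) (F i)) ->
  expoly s (\sum_(i <- r | P i) e i) (fun x => \prod_(i <- r | P i) F i x).
Proof.
move=> Fd; elim: r => [|i r ihr].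
  by rewrite big_nil; apply: eq_expoly (expoly_cst s 1) => x; rewrite big_nil.
rewrite big_cons; have [Pi|Pi] := boolP (P i); last first.
  by apply: eq_expoly ihr => x; rewrite big_cons (negbTE Pi).
by apply: eq_expoly (expolyM (Fd i Pi) ihr) => x; rewrite big_cons Pi.
Qed.

Lemma expoly_shift s d f c : expoly s d f -> expoly s d (fun x => f (x + c)).
Proof.
move=> [r szr fE]; set a := cexp (s * c).
exists ((a ^+ d)^-1 *: (r \Po (a ^+ 2 *: 'X))) => [|x].
  rewrite (leq_trans (size_scale_leq _ _)) //.
  rewrite (leq_trans (size_comp_poly_leq _ _)) // ltnS.
  have : (size (a ^+ 2 *: 'X : {poly C})%R <= 2)%N.
    by rewrite (leq_trans (size_scale_leq _ _)) // size_polyX.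
  by move: (size _) => m m2; nia.
rewrite fE hornerZ horner_comp hornerZ hornerX mulrDr cexpD -/a.
move: (cexp (s * x)) => b; clearbody a.
by rewrite !exprMn invfM -mulrA [b ^+ 2 * _]mulrC.
Qed.

Lemma expoly_csinh s c : expoly s 1 (fun x => csinh (s * x - c)).
Proof.
exists (2^-1 *: ((cexp c)^-1 *: 'X - (cexp c)%:P)) => [|x].
  rewrite (leq_trans (size_scale_leq _ _)) //.
  rewrite (leq_trans (size_polyD _ _)) // size_polyN geq_max.
  rewrite (leq_trans (size_scale_leq _ _)) ?size_polyX //.
  by rewrite (leq_trans (size_polyC_leq1 _)).
rewrite csinhE !cexpE.
have := cexp_neq0 c; have := cexp_neq0 (s * x).
move: (cexp _) (cexp _) => b a a0 b0.
by rewrite !hornerE /= expr1; field; rewrite a0 b0.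
Qed.

Lemma expoly_csinh1 c : expoly 1 1 (fun x => csinh (x - c)).
Proof. by apply: eq_expoly (expoly_csinh 1 c) => x; rewrite mul1r. Qed.

Lemma expoly_csinh_half c : expoly 2^-1 1 (fun x => csinh ((x - c) / 2)).
Proof.
apply: eq_expoly (expoly_csinh 2^-1 (c / 2)) => x.
by rewrite mulrBl [2^-1 * x]mulrC.
Qed.

Lemma expoly_ccosh_half c : expoly 2^-1 1 (fun x => ccosh ((x - c) / 2)).
Proof.
apply: eq_expoly (expolyZ (cexp (ipi / 2))^-1 (expoly_csinh_half (c - ipi))) => x.
by rewrite opprB addrA addrAC csinh_half_ipi mulKf ?cexp_neq0.
Qed.

Lemma expoly_prod_csinh (I : finType) (P : pred I) (c : I -> C) :
  expoly 1 #|P| (fun x => \prod_(i | P i) csinh (x - c i)).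
Proof. by rewrite -sum1_card; apply: expoly_prod => i _; apply: expoly_csinh1. Qed.

Lemma card_neq_ord (d : nat) (i : 'I_d.+1) : #|[pred l | l != i]| = d.
Proof. by rewrite cardC1 card_ord. Qed.

Lemma expoly_prod_csinh_but (d : nat) (i : 'I_d.+1) (c : 'I_d.+1 -> C) :
  expoly 1 d (fun x => \prod_(l | l != i) csinh (x - c l)).
Proof. by rewrite -[d in expoly _ d](card_neq_ord i); apply: expoly_prod_csinh. Qed.

Lemma cexp_sqr_inj x y : cexp x ^+ 2 = cexp y ^+ 2 -> csinh (x - y) = 0.
Proof.
have := cexp_neq0 x; have := cexp_neq0 y.
rewrite csinhE !cexpE; move: (cexp _) (cexp _) => a b b0 a0 ab.
apply/eqP; rewrite mulf_eq0 invr_eq0 pnatr_eq0 orbF.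
have -> : a / b - (a / b)^-1 = (a ^+ 2 - b ^+ 2) / (a * b) by field; rewrite a0 b0.
by rewrite ab subrr mul0r.
Qed.

(** Both functions are the same prefactor times a polynomial of degree at most [d] in [e^(2 x)];
    nodes that differ modulo [i pi] give [d + 1] distinct values of [e^(2 x)], too many for a
    nonzero difference. *)
Lemma expoly_uniq (d : nat) (t : 'I_d.+1 -> C) f g :
  (forall i j, i != j -> csinh (t i - t j) != 0) ->
  expoly 1 d f -> expoly 1 d g -> (forall i, f (t i) = g (t i)) -> f =1 g.
Proof.
move=> tD [r szr fE] [q szq gE] fg x; rewrite fE gE; congr (_ * _.[_]).
apply/eqP; rewrite -subr_eq0; apply/eqP.
apply: (@roots_geq_poly_eq0 _ _ [seq cexp (t i) ^+ 2 | i : 'I_d.+1]).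
- apply/allP => _ /mapP[i _ ->]; rewrite rootE hornerD hornerN subr_eq0.
  have := fg i; rewrite fE gE mul1r => /mulfI ->//.
  by rewrite invr_eq0 expf_neq0 ?cexp_neq0.
- rewrite map_inj_uniq ?enum_uniq // => i j /cexp_sqr_inj/eqP; apply: contraTeq.
  exact: tD.
- rewrite size_map size_enum_ord (leq_trans (size_polyD _ _)) // size_polyN.
  by rewrite geq_max szr.
Qed.

Lemma expoly_lagrange (d : nat) (t : 'I_d.+1 -> C) f y :
  (forall i j, i != j -> csinh (t i - t j) != 0) -> expoly 1 d f ->
  f y = \sum_i f (t i) *
          \prod_(l | l != i) (csinh (y - t l) / csinh (t i - t l)).
Proof.
move=> tD fd; move: y; apply: (expoly_uniq tD fd) => [|j].
  apply: expoly_sum => i _; apply: expolyZ.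
  apply: eq_expoly (expolyZ (\prod_(l | l != i) csinh (t i - t l))^-1
                            (expoly_prod_csinh_but i t)) => x.
  by rewrite [RHS]prodf_div [LHS]mulrC.
rewrite (bigD1 j) //= [X in _ + X]big1 ?addr0 => [|i ij].
  by rewrite big1 ?mulr1 // => l lj; rewrite divff // tD // eq_sym.
by rewrite (bigD1 j) 1?eq_sym //= subrr csinh0 !mul0r mulr0.
Qed.

(* Only the odd powers of [e^x] survive in this combination. *)
Lemma expoly_odd_part (d : nat) f : expoly 2^-1 (d.+1).*2 f ->
  expoly 1 d (fun x => f x - (-1) ^+ d.+1 * f (x + ipi)).
Proof.
(* With [y = e^x], the shift by [i pi] is [y -> - y], and the sign [(-1)^(d+1)] compensates the one
   of the prefactor [y^(-(d+1))]. What is left is [2 y O(y^2)] times this prefactor, [O] being the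
   odd part: the factor [y] lowers [d + 1] to [d]. *)
move=> [G szG fE]; exists (2 *: odd_poly G) => [|x].
  rewrite (leq_trans (size_scale_leq _ _)) // (leq_trans (size_odd_poly _)) //.
  by rewrite (leq_trans (half_leq szG)) // -[_.+1]/(true + _)%N half_bit_double.
have sqrE y : cexp (2^-1 * y) ^+ 2 = cexp y.
  by rewrite expr2 [2^-1 * y]mulrC cexp_half_sqr.
have dblE y : cexp (2^-1 * y) ^+ (d.+1).*2 = cexp y ^+ d.+1.
  by rewrite -mul2n exprM sqrE.
rewrite (fE x) (fE (x + ipi)).
rewrite (dblE x) (dblE (x + ipi)).
rewrite (sqrE x) (sqrE (x + ipi)).
rewrite [cexp (x + _)]cexpD cexp_ipi.
rewrite mulrN1.
rewrite mul1r.
move: (cexp x) (cexp_neq0 x) => e e0; rewrite hornerZ.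
have GE y : G.[y] = (even_poly G).[y ^+ 2] + (odd_poly G).[y ^+ 2] * y.
  by rewrite -[in LHS](poly_even_odd G) hornerD hornerM !horner_comp hornerXn hornerX.
rewrite !GE sqrrN (exprNn e d.+1) (exprS e d).
have := expf_neq0 d e0; have := sqrr_sign C d.+1; rewrite expr2.
have : (-1) ^+ d.+1 != 0 :> C by rewrite signr_eq0.
move: (e ^+ d) ((-1) ^+ _) => E S S0 SS E0.
have -> : (S * (e * E))^-1 = S / (e * E).
  by rewrite invfM; congr (_ / _); apply: (mulfI S0); rewrite SS divff.
rewrite [S * _]mulrA [S * (_ / _)]mulrA SS mul1r.
by field; rewrite e0 E0.
Qed.

(** Each index belongs to exactly [d] of the pairs. This collects the exponentials released by
    [csinh_sub] from a Vandermonde product. *)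
Lemma prod_lt_pairM (T : comRingType) (d : nat) (a : 'I_d.+1 -> T) :
  \prod_(i < d.+1) \prod_(j < d.+1 | (i < j)%N) (a i * a j) = \prod_i a i ^+ d.
Proof.
rewrite (eq_bigr (fun i : 'I_d.+1 => (\prod_(j < d.+1 | (i < j)%N) a i) *
    \prod_(j < d.+1 | (i < j)%N) a j)) => [|i _]; last by rewrite -big_split.
rewrite big_split /= [X in _ * X](exchange_big_dep xpredT) //=.
rewrite -big_split /=.
apply: eq_bigr => i _; rewrite !prodr_const -exprD; congr (_ ^+ _).
transitivity (#|[pred j : 'I_d.+1 | (i < j)%N]| + #|[pred j : 'I_d.+1 | (j < i)%N]|)%N => //.
rewrite -[RHS](card_neq_ord i) -cardUI [X in (_ + X)%N]eq_card0 ?addn0 => [|j].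
  by apply: eq_card => j; rewrite !inE -neq_ltn eq_sym.
by rewrite !inE; case: ltngtP.
Qed.

Lemma csinh_sub x y :
  cexp x ^+ 2 - cexp y ^+ 2 = 2 * (cexp y * cexp x) * csinh (x - y).
Proof.
rewrite csinhE !cexpE; have := cexp_neq0 x; have := cexp_neq0 y.
by move: (cexp _) (cexp _) => a b b0 a0; field; rewrite a0 b0.
Qed.

(** The matrix splits into the diagonal of prefactors [e^(-d t_m)], an ordinary Vandermonde matrix
    in [e^(2 t_m)], and the matrix of coefficients. The exponentials produced by rewriting
    differences of [e^(2 t)] as sinh cancel the prefactors exactly. *)
Lemma det_expoly (d : nat) (u : 'I_d.+1 -> C -> C) :
  (forall k, expoly 1 d (u k)) ->
  exists c, forall t : 'I_d.+1 -> C, \det (\matrix_(m, k) u k (t m)) = c * vdm t.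
Proof.
move=> ud.
have /choice[r rP] k : exists r : {poly C},
    (size r <= d.+1)%N /\ forall x, u k x = (cexp (1 * x) ^+ d)^-1 * r.[cexp (1 * x) ^+ 2].
  by have [r ? ?] := ud k; exists r.
exists (\prod_(i < d.+1) \prod_(j < d.+1 | (i < j)%N) 2
        * \det (\matrix_(l, k) (r k)`_(l : 'I_d.+1))) => t.
pose a : 'rV[C]_d.+1 := \row_m cexp (t m) ^+ 2.
have -> : \matrix_(m, k) u k (t m) =
    diag_mx (\row_m (cexp (t m) ^+ d)^-1) *m
    ((Vandermonde d.+1 a)^T *m \matrix_(l, k) (r k)`_(l : 'I_d.+1)).
  apply/matrixP => m k; rewrite mul_diag_mx !mxE.
  have [szr ->] := rP k; rewrite mul1r (horner_coef_wide _ szr).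
  congr (_ * _); by apply: eq_bigr => l _; rewrite !mxE mulrC.
rewrite !det_mulmx det_tr det_Vandermonde det_diag.
have -> : \prod_(i < d.+1) \prod_(j < d.+1 | (i < j)%N) (a 0 j - a 0 i) =
    (\prod_(i < d.+1) \prod_(j < d.+1 | (i < j)%N) 2) * 
    (\prod_i cexp (t i) ^+ d) * vdm t.
  rewrite -prod_lt_pairM /vdm -!big_split /=; apply: eq_bigr => i _.
  rewrite -!big_split /=; apply: eq_bigr => j _.
  by rewrite !mxE csinh_sub.
under eq_bigr do rewrite mxE.
rewrite prodfV; set X := \prod_i _; have X0 : X != 0.
  by apply/prodf_neq0 => i _; rewrite expf_neq0 ?cexp_neq0.
move: (\det _) (vdm t) (\prod_i _) => A B E.
by field.
Qed.

End ExpPoly.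

(** * The quantum inverse problem *)

Section CommMx.
Context {F : fieldType} {k : nat}.
Implicit Types A B C D P Q : 'M[F]_k.

Lemma comm_mxZ c A B : comm_mx A B -> comm_mx A (c *: B).
Proof. by rewrite /comm_mx -scalemxAr -scalemxAl => ->. Qed.

Lemma comm_mx_prod (I : eqType) (s : seq I) (G : I -> 'M[F]_k) A :
  (forall x, x \in s -> comm_mx A (G x)) -> comm_mx A (\big[mulmx/1%:M]_(x <- s) G x).
Proof.
elim: s => [|x s ihs] h; first by rewrite big_nil; apply: comm_mx1.
rewrite big_cons; apply: comm_mxM; first by apply: h; rewrite mem_head.
by apply: ihs => y ys; apply: h; rewrite in_cons ys orbT.
Qed.

Lemma mulmx_step A B C D P Q d : P *m Q = d *: D ->
  A *m P *m (Q *m B *m C) = d *: (A *m (D *m B *m C)).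
Proof. by move=> PQ; rewrite -!mulmxA [P *m _]mulmxA PQ -scalemxAl -scalemxAr. Qed.

Lemma big_mulmx_rcons (I : Type) (s : seq I) (G : I -> 'M[F]_k) x :
  \big[mulmx/1%:M]_(y <- rcons s x) G y = (\big[mulmx/1%:M]_(y <- s) G y) *m G x.
Proof.
elim: s => [|y s ihs] /=; first by rewrite big_cons !big_nil mulmx1 mul1mx.
by rewrite !big_cons ihs mulmxA.
Qed.

(** The index type is left free because the lemma serves both for one site and for a pair of sites,
    whose matrix units are indexed by pairs. *)
Lemma matrix_units_mul (J : finType) (e : J -> J -> 'M[F]_k) (f g : J -> J -> F) :
  (forall a b b' d, e a b *m e b' d = (b == b')%:R *: e a d) ->
  (\sum_a \sum_b f a b *: e a b) *m (\sum_a \sum_b g a b *: e a b) =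
  \sum_a \sum_b (\sum_l f a l * g l b) *: e a b.
Proof.
move=> e_mul; rewrite mulmx_suml; apply: eq_bigr => a _.
rewrite mulmx_suml; under eq_bigr => l _ do rewrite mulmx_sumr.
transitivity (\sum_l \sum_d (f a l * g l d) *: e a d); last first.
  by rewrite exchange_big /=; apply: eq_bigr => d _; rewrite -scaler_suml.
apply: eq_bigr => l _; rewrite (bigD1 l) //= [X in _ + X]big1 ?addr0.
  rewrite mulmx_sumr; apply: eq_bigr => d _.
  by rewrite -scalemxAl -scalemxAr e_mul eqxx scale1r scalerA.
move=> m /negbTE ml; rewrite mulmx_sumr big1 // => d _.
by rewrite -scalemxAl -scalemxAr e_mul eq_sym ml scale0r !scaler0.
Qed.

End CommMx.

(** * The inverse problem for abstract matrix units attached to sites *)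

Section LocalOperators.
Context {F : fieldType} {k : nat} {S : eqType}.
(** [E x i j] stands for the matrix unit at the site [x]. Only the algebraic relations below enter,
    together with two properties of the R-matrix: it is a multiple of the permutation at 0, and it
    is unitary up to a scalar. Tensor products thus never have to be manipulated. *)
Variable E : S -> 'I_2 -> 'I_2 -> 'M[F]_k.
Hypothesis E_mul : forall x i j l m, E x i j *m E x l m = (j == l)%:R *: E x i m.
Hypothesis E_comm : forall x y i j l m, x != y -> comm_mx (E x i j) (E y l m).
Hypothesis E_one : forall x, \sum_i E x i i = 1%:M.

Variables (r : F -> 'I_2 -> 'I_2 -> 'I_2 -> 'I_2 -> F) (c : F) (rho : F -> F).
Hypothesis r0 : forall i s j t, r 0 i s j t = c * ((i == t) && (s == j))%:R.
Hypothesis r_unitary : forall lam i s j t,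
  \sum_l \sum_m r lam i s l m * r (- lam) m l t j =
    rho lam * ((i == j) && (s == t))%:R.

Variable xi : S -> F.
Implicit Types (x y : S) (s : seq S) (A : 'M[F]_k) (X Y : 'I_2 -> 'I_2 -> 'M[F]_k).
Implicit Types (M : 'M[F]_2).

Definition bmul X Y i j : 'M[F]_k := \sum_l X i l *m Y l j.

Definition lax x lam i j : 'M[F]_k := \sum_s \sum_t r lam i s j t *: E x s t.

(** The head of the list is the rightmost factor, so that an increasing enumeration of the sites
    yields the order of [monodromy]. *)
Fixpoint mono s lam : 'I_2 -> 'I_2 -> 'M[F]_k :=
  if s is x :: s' then bmul (mono s' lam) (lax x (lam - xi x))
  else fun i j => (i == j)%:R%:M.

Definition off x A := forall i j, comm_mx A (E x i j).

(* [X] with the auxiliary space identified with the site [x]. *)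
Definition plug x X : 'M[F]_k := \sum_i \sum_j X i j *m E x i j.

Definition site_op x M : 'M[F]_k := \sum_i \sum_j M i j *: E x i j.

Definition mono_tr M s lam : 'M[F]_k := \sum_i \sum_j M i j *: mono s lam j i.

Lemma comm_lax A x lam i j : off x A -> comm_mx A (lax x lam i j).
Proof.
by move=> Ax; do 2!apply: comm_mx_sum => ? _; apply: comm_mxZ; apply: Ax.
Qed.

Lemma comm_mono A s lam i j :
  (forall x, x \in s -> off x A) -> comm_mx A (mono s lam i j).
Proof.
elim: s i j => [|x s ihs] i j h /=; first exact: comm_mx_scalar.
apply: comm_mx_sum => l _; apply: comm_mxM.
  by apply: ihs => y ys; apply: h; rewrite in_cons ys orbT.
by apply: comm_lax; apply: h; rewrite mem_head.
Qed.

Lemma comm_plug A x X :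
  off x A -> (forall i j, comm_mx A (X i j)) -> comm_mx A (plug x X).
Proof.
by move=> Ax AX; do 2!apply: comm_mx_sum => ? _; apply: comm_mxM; auto.
Qed.

Lemma comm_site_op A x M : off x A -> comm_mx A (site_op x M).
Proof. by move=> Ax; do 2!apply: comm_mx_sum => ? _; apply: comm_mxZ; auto. Qed.

Lemma off_site_op y x M : y != x -> off y (site_op x M).
Proof.
by move=> yx i j; apply/comm_mx_sym/comm_site_op => l m; apply: E_comm.
Qed.

Lemma off_lax y x lam i j : y != x -> off y (lax x lam i j).
Proof.
by move=> yx l m; apply/comm_mx_sym/comm_lax => a b; apply: E_comm.
Qed.

Lemma off_mono y s lam i j : y \notin s -> off y (mono s lam i j).
Proof.
move=> ys l m; apply/comm_mx_sym/comm_mono => x xs a b; apply: E_comm.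
by apply: contraNneq ys => ->.
Qed.

Lemma off_mul y A A' : off y A -> off y A' -> off y (A *m A').
Proof. by move=> Ay A'y i j; apply/comm_mx_sym/comm_mxM; apply/comm_mx_sym. Qed.

Lemma bmulA X Y Z i j : bmul X (bmul Y Z) i j = bmul (bmul X Y) Z i j.
Proof.
rewrite /bmul; under eq_bigr do rewrite mulmx_sumr.
rewrite exchange_big /=; apply: eq_bigr => l _; rewrite mulmx_suml.
by apply: eq_bigr => m _; rewrite mulmxA.
Qed.

Lemma eq_bmul X X' Y Y' i j : (forall i j, X i j = X' i j) ->
  (forall i j, Y i j = Y' i j) -> bmul X Y i j = bmul X' Y' i j.
Proof. by move=> XX YY; apply: eq_bigr => l _; rewrite XX YY. Qed.

Lemma mono_cat s1 s2 lam i j :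
  mono (s1 ++ s2) lam i j = bmul (mono s2 lam) (mono s1 lam) i j.
Proof.
elim: s1 i j => [|x s1 ihs] i j /=.
  rewrite /bmul (bigD1 j) //= eqxx mulmx1 big1 ?addr0 // => l /negbTE ->.
  by rewrite scalemx1 mulmx0 || rewrite raddf0 mulmx0.
by rewrite bmulA; apply: eq_bmul.
Qed.

(** Since the entries of [Y] commute with the matrix units at [x], these units can be brought
    together, and their product contracts the intermediate auxiliary index. *)
Lemma plug_bmul x X Y : (forall i j, off x (Y i j)) ->
  plug x (bmul X Y) = plug x X *m plug x Y.
Proof.
move=> Yx; rewrite /plug mulmx_suml; apply: eq_bigr => i _.
rewrite mulmx_suml; under [RHS]eq_bigr => l _ do rewrite mulmx_sumr.
transitivity (\sum_l \sum_j X i l *m Y l j *m E x i j).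
  rewrite exchange_big /=; apply: eq_bigr => j _; by rewrite mulmx_suml.
apply: eq_bigr => l _.
have key m j : X i l *m E x i l *m (Y m j *m E x m j) =
    (l == m)%:R *: (X i l *m Y m j *m E x i j).
  rewrite mulmxA -[X i l *m _ *m _]mulmxA -Yx mulmxA -[LHS]mulmxA E_mul.
  by rewrite -scalemxAr.
rewrite [RHS](bigD1 l) //= [X in _ + X]big1 ?addr0.
  by rewrite mulmx_sumr; apply: eq_bigr => j _; rewrite key eqxx scale1r.
move=> m /negbTE ml; rewrite mulmx_sumr big1 // => j _.
by rewrite key eq_sym ml scale0r.
Qed.

Lemma plug_nil x lam : plug x (mono [::] lam) = 1%:M.
Proof.
rewrite -(E_one x); apply: eq_bigr => i _; rewrite (bigD1 i) //= eqxx mul1mx.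
by rewrite big1 ?addr0 // => j; rewrite eq_sym => /negbTE ->; rewrite raddf0 mul0mx.
Qed.

Lemma plug_mono_cons x y s lam : x \notin y :: s ->
  plug x (mono (y :: s) lam) = plug x (mono s lam) *m plug x (lax y (lam - xi y)).
Proof.
rewrite inE negb_or => /andP[xy _].
by rewrite plug_bmul // => i j; apply: off_lax.
Qed.

(** This is [R_xy(lam) R_yx(-lam) = rho(lam)] on two physical sites. Both factors are expanded on
    the matrix units of the pair; the second exchanges the roles of [x] and [y], which is why the
    indices of the second [r] in [r_unitary] are swapped. *)
Lemma plug_lax_unitary x y lam : x != y ->
  plug x (lax y lam) *m plug y (lax x (- lam)) = (rho lam)%:M.
Proof.
move=> xy; pose e (a b : 'I_2 * 'I_2) := E x a.1 b.1 *m E y a.2 b.2.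
have e_mul a b b' d : e a b *m e b' d = (b == b')%:R *: e a d.
  rewrite /e -mulmxA [E y _ _ *m (_ *m _)]mulmxA -(E_comm _ _ _ _ xy).
  rewrite -[_ *m _ *m E y _ _]mulmxA E_mul mulmxA E_mul -scalemxAl -scalemxAr.
  by rewrite scalerA -natrM mulnb; case: b b' => [i j] [l m].
have -> : plug x (lax y lam) =
    \sum_a \sum_b r lam a.1 a.2 b.1 b.2 *: e a b.
  transitivity (\sum_i \sum_s \sum_j \sum_t r lam i s j t *: e (i, s) (j, t)).
    apply: eq_bigr => i _; rewrite exchange_big /=; apply: eq_bigr => j _.
    rewrite mulmx_suml; apply: eq_bigr => s _; rewrite mulmx_suml.
    by apply: eq_bigr => t _; rewrite -scalemxAl /e /= (E_comm _ _ _ _ xy).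
  rewrite pair_bigA /=; apply: eq_bigr => -[i s] _; rewrite pair_bigA /=.
  by apply: eq_bigr => -[].
have -> : plug y (lax x (- lam)) =
    \sum_a \sum_b r (- lam) a.2 a.1 b.2 b.1 *: e a b.
  transitivity (\sum_s \sum_i \sum_t \sum_j r (- lam) i s j t *: e (s, i) (t, j)).
    rewrite [RHS]exchange_big /=; apply: eq_bigr => i _.
    under [RHS]eq_bigr do rewrite exchange_big /=.
    rewrite [RHS]exchange_big /=; apply: eq_bigr => j _.
    rewrite mulmx_suml; apply: eq_bigr => s _; rewrite mulmx_suml.
    by apply: eq_bigr => t _; rewrite -scalemxAl.
  rewrite pair_bigA /=; apply: eq_bigr => -[i s] _; rewrite pair_bigA /=.
  by apply: eq_bigr => -[].
rewrite matrix_units_mul //.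
transitivity (\sum_a \sum_b (rho lam * (a == b)%:R) *: e a b).
  apply: eq_bigr => a _; apply: eq_bigr => b _; congr (_ *: _).
  rewrite -(pair_bigA _ (fun l m => r lam a.1 a.2 l m * r (- lam) m l b.2 b.1)) /=.
  by rewrite r_unitary; case: a b => [i s] [j t].
transitivity (rho lam *: \sum_a e a a).
  rewrite scaler_sumr; apply: eq_bigr => a _; rewrite (bigD1 a) //= eqxx mulr1.
  by rewrite big1 ?addr0 // => b; rewrite eq_sym => /negbTE ->; rewrite mulr0 scale0r.
rewrite -(pair_bigA _ (fun i t => E x i i *m E y t t)) /=.
by under eq_bigr do rewrite -mulmx_sumr E_one mulmx1; rewrite E_one scalemx1.
Qed.

Lemma site_opM x M M' : site_op x (M *m M') = site_op x M *m site_op x M'.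
Proof.
rewrite /site_op matrix_units_mul //.
by do 2!apply: eq_bigr => ? _; rewrite mxE.
Qed.

(** The Lax factor of [x] becomes [c] times a permutation, which transports the auxiliary trace to
    the space of [x]. By cyclicity the sites of [s1], originally on the far right, end up to the
    left of [M], and those of [s2] to its right. *)
Lemma mono_tr_site M s1 x s2 : uniq (s1 ++ x :: s2) ->
  mono_tr M (s1 ++ x :: s2) (xi x) =
    c *: (plug x (mono s1 (xi x)) *m site_op x M *m plug x (mono s2 (xi x))).
Proof.
rewrite cat_uniq /= negb_or => /and3P[us1 /andP[xs1 s12] /andP[xs2 us2]].
set T1 := mono s1 _; set T2 := mono s2 _.
have offT1 i j : off x (T1 i j) by apply: off_mono.
have offT2 i j : off x (T2 i j) by apply: off_mono.
have comm12 i j l m : comm_mx (T1 i j) (T2 l m).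
  apply: comm_mono => y ys2; apply: off_mono.
  by apply: contra s12 => ys1; apply/hasP; exists y.
have laxE i j : lax x (xi x - xi x) i j = c *: E x j i.
  rewrite subrr /lax (bigD1 j) //= (bigD1 i) //= r0 !eqxx mulr1.
  rewrite big1 ?addr0 => [|t /negbTE ti]; last first.
    by rewrite r0 [i == t]eq_sym ti mulr0 scale0r.
  rewrite big1 ?addr0 // => s /negbTE sj; rewrite big1 // => t _.
  by rewrite r0 sj andbF mulr0 scale0r.
have monoE i j : mono (s1 ++ x :: s2) (xi x) j i =
    c *: \sum_l \sum_m T1 l i *m T2 j m *m E x l m.
  rewrite mono_cat scaler_sumr; apply: eq_bigr => l _ /=.
  rewrite -/T1 -/T2 /bmul mulmx_suml scaler_sumr; apply: eq_bigr => m _.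
  rewrite laxE -scalemxAr -scalemxAl; congr (_ *: _).
  by rewrite comm12 -[RHS]mulmxA offT1 mulmxA.
rewrite /mono_tr.
transitivity (c *: \sum_i \sum_j \sum_l \sum_m M i j *: (T1 l i *m T2 j m *m E x l m)).
  rewrite scaler_sumr; apply: eq_bigr => i _; rewrite scaler_sumr.
  apply: eq_bigr => j _; rewrite monoE scalerA mulrC -scalerA; congr (_ *: _).
  rewrite scaler_sumr; apply: eq_bigr => l _.
  by rewrite scaler_sumr; apply: eq_bigr.
congr (_ *: _).
have plugM : plug x T1 *m site_op x M =
    \sum_l \sum_i \sum_j M i j *: (T1 l i *m E x l j).
  rewrite /plug mulmx_suml; apply: eq_bigr => l _; rewrite mulmx_suml.
  apply: eq_bigr => i _; rewrite /site_op mulmx_sumr (bigD1 i) //=.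
  rewrite [X in _ + X]big1 ?addr0 => [|a /negbTE ai]; last first.
    rewrite mulmx_sumr big1 // => b _; rewrite -scalemxAr -mulmxA E_mul.
    by rewrite eq_sym ai scale0r mulmx0 scaler0.
  rewrite mulmx_sumr; apply: eq_bigr => j _.
  by rewrite -scalemxAr -mulmxA E_mul eqxx scale1r.
rewrite plugM mulmx_suml.
under [LHS]eq_bigr do rewrite exchange_big /=.
rewrite exchange_big /=; apply: eq_bigr => l _.
rewrite mulmx_suml; apply: eq_bigr => i _; rewrite mulmx_suml.
apply: eq_bigr => j _; rewrite /plug mulmx_sumr [RHS](bigD1 j) //=.
rewrite [X in _ = _ + X]big1 ?addr0 => [|a /negbTE aj]; last first.
  rewrite mulmx_sumr big1 // => b _; rewrite -scalemxAl -mulmxA.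
  by rewrite [E x l j *m _]mulmxA -offT2 -[_ *m _ *m E x a b]mulmxA E_mul eq_sym aj
    scale0r !mulmx0 scaler0.
rewrite mulmx_sumr; apply: eq_bigr => m _; rewrite -scalemxAl; congr (_ *: _).
by rewrite -!mulmxA [E x l j *m _]mulmxA -offT2 -[_ *m _ *m E x j m]mulmxA E_mul eqxx scale1r.
Qed.

(** The R-matrices linking each site of [s1] to all sites of [s2]: what survives of the transfer
    matrices at [s1] once the links inside [s1] have cancelled. *)
Definition tail_prod s1 s2 : 'M[F]_k :=
  \big[mulmx/1%:M]_(x <- s1) plug x (mono s2 (xi x)).

Lemma comm_tail_prod A s1 s2 :
  (forall x, x \in s1 ++ s2 -> off x A) -> comm_mx A (tail_prod s1 s2).
Proof.
move=> h; apply: comm_mx_prod => x xs1; apply: comm_plug => [|i j].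
  by apply: h; rewrite mem_cat xs1.
by apply: comm_mono => y ys2; apply: h; rewrite mem_cat ys2 orbT.
Qed.

(** Each [y] in [s1] is linked to [x] once with argument [xi y - xi x] and once with the opposite
    argument; unitarity cancels the pair. The scalar [d], a product of values of [rho], may vanish:
    it will occur on both sides of the inverse problem. *)
Lemma tail_prod_plug s1 x s2 : uniq (s1 ++ x :: s2) -> exists d,
  tail_prod s1 (x :: s2) *m plug x (mono s1 (xi x)) = d *: tail_prod s1 s2.
Proof.
elim: s1 => [|y s1 ihs].
  exists 1; rewrite /tail_prod !big_nil mul1mx scale1r.
  exact: (plug_nil x 0).
rewrite cat_cons cons_uniq mem_cat inE !negb_or => /andP[/and3P[ys1 yx ys2] us].
have [d ihd] := ihs us; exists (rho (xi y - xi x) * d).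
have := us; rewrite cat_uniq /= negb_or => /and3P[us1 /andP[xs1 _] /andP[xs2 _]].
have xy : x != y by rewrite eq_sym.
rewrite /tail_prod !big_cons -!/(tail_prod _ _).
have -> : plug y (mono (x :: s2) (xi y)) =
    plug y (mono s2 (xi y)) *m plug y (lax x (xi y - xi x)).
  by apply: plug_mono_cons; rewrite inE negb_or yx.
rewrite plug_mono_cons ?inE ?negb_or ?xy //.
rewrite mulmxA -[_ *m _ *m plug x (mono s1 _)]mulmxA ihd.
rewrite -scalemxAr -scalemxAl -mulmxA -mulmxA.
(* The remaining tail lives away from [x] and [y], so the two opposite links between these sites can
   be made adjacent. *)
have comm_ts : comm_mx (plug x (lax y (xi x - xi y))) (tail_prod s1 s2).
  apply: comm_tail_prod => z; rewrite mem_cat => zs.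
  have zx : z != x by apply: contraTneq zs => ->; rewrite negb_or xs1.
  have zy : z != y by apply: contraTneq zs => ->; rewrite negb_or ys1.
  move=> i j; apply/comm_mx_sym/comm_plug => [l m|l m]; first exact: E_comm.
  exact/comm_mx_sym/off_lax.
rewrite -comm_ts [plug y (lax _ _) *m _]mulmxA -[xi x - xi y]opprB.
by rewrite plug_lax_unitary 1?eq_sym // mul_scalar_mx -scalemxAr scalerA mulrC.
Qed.

Definition transfer_prod M s0 s : 'M[F]_k :=
  \big[mulmx/1%:M]_(x <- s) mono_tr M s0 (xi x).

Lemma transfer_prodE M s1 s2 : uniq (s1 ++ s2) -> exists2 Z,
  transfer_prod M (s1 ++ s2) s1 = Z *m tail_prod s1 s2 &
  forall y, y \in s2 -> off y Z.
Proof.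
elim/last_ind: s1 s2 => [|s1 x ihs] s2 us.
  exists 1%:M; first by rewrite /transfer_prod /tail_prod !big_nil mulmx1.
  by move=> y _ i j; apply: comm1mx.
rewrite cat_rcons in us *; have [Z ZE Zoff] := ihs _ us.
have [d dE] := tail_prod_plug us.
have := us; rewrite cat_uniq /= negb_or => /and3P[_ /andP[xs1 _] /andP[xs2 _]].
exists ((c * d) *: (Z *m site_op x M)) => [|y ys2]; last first.
  move=> i j; apply/comm_mx_sym/comm_mxZ/comm_mx_sym/off_mul => //.
    by apply: Zoff; rewrite inE ys2 orbT.
  by apply: off_site_op; apply: contraTneq ys2 => ->.
have comm_ts : comm_mx (site_op x M) (tail_prod s1 s2).
  apply: comm_tail_prod => z; rewrite mem_cat => zs; apply: off_site_op.
  by apply: contraTneq zs => ->; rewrite negb_or xs1.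
rewrite /transfer_prod /tail_prod !big_mulmx_rcons -/(tail_prod _ _).
rewrite -/(transfer_prod _ _ _) ZE mono_tr_site // -scalemxAr -scalemxAl.
rewrite -scalerA; congr (_ *: _).
by rewrite (mulmx_step _ _ _ dE) -comm_ts -!mulmxA.
Qed.

(* At [xi x] the R-matrix of the site [x] is a permutation, so the transfer
   matrix is a product of R-matrices through [x]; by unitarity those linking [x]
   to the earlier sites cancel against the earlier transfer matrices, leaving
   [site_op x Z] next to operators away from [x]. *)
Lemma inverse_problem M Z s1 x s2 : uniq (s1 ++ x :: s2) ->
  let s := s1 ++ x :: s2 in
  site_op x Z *m (transfer_prod M s s1 *m mono_tr M s (xi x)) =
  transfer_prod M s s1 *m mono_tr (Z *m M) s (xi x).
Proof.
move=> us s; rewrite !mono_tr_site //.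
have [Z0 -> Z0off] := transfer_prodE M us.
have [d dE] := tail_prod_plug us.
have := us; rewrite cat_uniq /= negb_or => /and3P[_ /andP[xs1 _] /andP[xs2 _]].
have comm_ts : comm_mx (site_op x Z) (tail_prod s1 s2).
  apply: comm_tail_prod => z; rewrite mem_cat => zs; apply: off_site_op.
  by apply: contraTneq zs => ->; rewrite negb_or xs1.
have comm_Z : comm_mx (site_op x Z) Z0.
  by apply/comm_mx_sym/comm_site_op/Z0off; rewrite mem_head.
rewrite -!scalemxAr; congr (_ *: _); rewrite !(mulmx_step _ _ _ dE) -scalemxAr.
congr (_ *: _); rewrite [LHS]mulmxA comm_Z site_opM -!mulmxA; congr (Z0 *m _).
by rewrite [LHS]mulmxA comm_ts -!mulmxA.
Qed.

End LocalOperators.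

Section Mkop.
Context {C : fieldType} {I : finType}.
Implicit Types f g : I -> I -> C.

Lemma eq_mkop f g : (forall x y, f x y = g x y) -> mkop f = mkop g.
Proof. by move=> fg; apply/matrixP => x y; rewrite !mxE. Qed.

Lemma mkopM f g : mkop f *m mkop g = mkop (fun x y => \sum_z f x z * g z y).
Proof.
apply/matrixP => x y; rewrite !mxE (reindex_onto enum_rank enum_val) => [|i _].
  by apply: eq_big => z; rewrite ?enum_rankK ?eqxx // !mxE enum_rankK.
exact: enum_valK.
Qed.

Lemma mkop_entry (M : 'M[C]_#|I|) : M = mkop (entry M).
Proof. by apply/matrixP => x y; rewrite mxE /entry !enum_valK. Qed.

Lemma mkop1 : mkop (fun x y : I => (x == y)%:R) = 1%:M :> 'M[C]_#|I|.
Proof. by apply/matrixP => x y; rewrite !mxE (inj_eq enum_val_inj). Qed.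

Lemma mkop_sum (J : finType) (P : pred J) (h : J -> I -> I -> C) :
  \sum_(j | P j) mkop (h j) = mkop (fun x y => \sum_(j | P j) h j x y).
Proof. by apply/matrixP => x y; rewrite summxE mxE; apply: eq_bigr => j _; rewrite mxE. Qed.

Lemma mkopZ c f : c *: mkop f = mkop (fun x y => c * f x y).
Proof. by apply/matrixP => x y; rewrite !mxE. Qed.

Lemma entry_mkop f x y : entry (mkop f) x y = f x y.
Proof. by rewrite /entry mxE !enum_rankK. Qed.

End Mkop.

(** * The six-vertex model as an instance of the abstract sites *)

Section TensorModel.
Context {R : realType} {N : nat}.
Local Notation C := (R[i]).
Variables (eta : C) (xi : 'I_N -> C).
Implicit Types (m : 'I_N) (i j : 'I_2) (h : config N).

Definition upd m i h : config N := [ffun l => if l == m then i else h l].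

Lemma upd_same m i j h : upd m i (upd m j h) = upd m i h.
Proof. by apply/ffunP => l; rewrite !ffunE; case: (l == m). Qed.

Lemma updE m i h : upd m i h m = i. Proof. by rewrite ffunE eqxx. Qed.

Lemma updC m m' i j h : m != m' -> upd m i (upd m' j h) = upd m' j (upd m i h).
Proof.
move=> mm'; apply/ffunP => l; rewrite !ffunE.
by case: (eqVneq l m) => // ->; rewrite (negbTE mm').
Qed.

Lemma upd_id m h : upd m (h m) h = h.
Proof. by apply/ffunP => l; rewrite !ffunE; case: eqVneq => [->|]. Qed.

Definition unit_op m i j : 'M[C]_#|config N| :=
  mkop (fun s t : config N => ((t m == j) && (s == upd m i t))%:R).

Lemma unit_op_mul m i j k l :
  unit_op m i j *m unit_op m k l = (j == k)%:R *: unit_op m i l.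
Proof.
rewrite mkopM mkopZ; apply: eq_mkop => s t.
rewrite (bigD1 (upd m k t)) //= big1 ?addr0 => [|u /negbTE ut]; last first.
  by rewrite ut andbF mulr0.
rewrite updE upd_same eqxx andbT -!natrM !mulnb [k == j]eq_sym.
by congr (_%:R); case: (j == k); case: (t m == l); case: (s == _).
Qed.

Lemma unit_op_comm m m' i j k l :
  m != m' -> comm_mx (unit_op m i j) (unit_op m' k l).
Proof.
move=> mm'; rewrite /comm_mx !mkopM; apply: eq_mkop => s t.
rewrite (bigD1 (upd m' k t)) //= big1 ?addr0 => [|u /negbTE ut]; last first.
  by rewrite ut andbF mulr0.
rewrite (bigD1 (upd m i t)) //= big1 ?addr0 => [|u /negbTE ut]; last first.
  by rewrite ut andbF mulr0.
rewrite !ffunE (negbTE mm') [m' == m]eq_sym (negbTE mm') !eqxx !andbT -!natrM !mulnb.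
by rewrite updC // andbAC -andbA andbC -andbA; congr (_%:R); do 3 case: (_ == _).
Qed.

Lemma unit_op_one m : \sum_i unit_op m i i = 1%:M.
Proof.
rewrite mkop_sum -mkop1; apply: eq_mkop => s t.
rewrite (bigD1 (t m)) //= eqxx upd_id big1 ?addr0 // => i.
by rewrite eq_sym => /negbTE ->.
Qed.

Lemma R_entry0 i s j t :
  R_entry eta 0 i s j t = csinh eta * ((i == t) && (s == j))%:R.
Proof.
rewrite /R_entry add0r csinh0.
by case: i s j t => [[|[|//]] ?] [[|[|//]] ?] [[|[|//]] ?] [[|[|//]] ?];
  rewrite -!val_eqE /= ?mulr1 ?mulr0.
Qed.

Lemma csinh_sqrB (x y : C) :
  csinh (x + y) * csinh (- x + y) = csinh y ^+ 2 - csinh x ^+ 2.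
Proof.
rewrite !csinhE !cexpE; have := cexp_neq0 x; have := cexp_neq0 y.
by move: (cexp _) (cexp _) => a b b0 a0; field; rewrite a0 b0.
Qed.

(** On mixed indices the diagonal entry is [sinh(eta)^2 - sinh(lam)^2], which [csinh_sqrB]
    identifies with the entry on equal indices. *)
Lemma R_entry_unitary lam i s j t :
  \sum_l \sum_m R_entry eta lam i s l m * R_entry eta (- lam) m l t j =
    csinh (lam + eta) * csinh (- lam + eta) * ((i == j) && (s == t))%:R.
Proof.
have := csinh_sqrB lam eta; rewrite !big_ord_recl !big_ord0 /R_entry csinhN.
move: (csinh (lam + eta)) (csinh (- lam + eta)) (csinh lam) (csinh eta).
move=> a b c d abE.
by case: i s j t => [[|[|//]] ?] [[|[|//]] ?] [[|[|//]] ?] [[|[|//]] ?];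
  rewrite -!val_eqE /= ?mulr1 ?mulr0 ?abE; ring.
Qed.

Local Notation mono := (mono unit_op (R_entry eta) xi).

Lemma aux_blockM i j (X Y : 'M[C]_#|aux_config N|) :
  aux_block i j (X *m Y) = \sum_l aux_block i l X *m aux_block l j Y.
Proof.
rewrite [X]mkop_entry [Y]mkop_entry mkopM.
under eq_bigr do rewrite mkopM; rewrite mkop_sum; apply: eq_mkop => s t.
rewrite entry_mkop pair_bigA /=; apply: eq_bigr => -[l u] _ /=.
by rewrite !entry_mkop.
Qed.

Lemma aux_block_R0 m lam i j :
  aux_block i j (R0 eta m lam) = lax unit_op (R_entry eta) m lam i j.
Proof.
rewrite /lax; under eq_bigr => s _.
  by under eq_bigr do rewrite mkopZ; rewrite mkop_sum; over.
rewrite mkop_sum; apply: eq_mkop => s t; rewrite entry_mkop /=.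
rewrite (bigD1 (s m)) //= [X in _ + X]big1 ?addr0 => [|a am]; last first.
  rewrite big1 // => b _; case: (s =P upd m a t) => [sE|]; last by rewrite andbF mulr0.
  by move: am; rewrite sE updE eqxx.
rewrite (bigD1 (t m)) //= eqxx big1 ?addr0 => [|b]; last first.
  by rewrite eq_sym => /negbTE ->; rewrite mulr0.
case: ifP => [/forallP st|/negP nst].
  rewrite (_ : s == _) ?mulr1 //; apply/eqP/ffunP => l; rewrite ffunE.
  by case: eqVneq => [->//|lm]; apply/eqP; have := st l; rewrite lm.
case: (s =P _) => [sE|]; last by rewrite mulr0.
by case: nst; apply/forallP => l; apply/implyP => lm; rewrite sE ffunE (negbTE lm).
Qed.

Lemma aux_block1 i j : aux_block i j (1%:M : 'M[C]_#|aux_config N|) = (i == j)%:R%:M.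
Proof.
rewrite -mkop1 -scalemx1 -mkop1 mkopZ; apply: eq_mkop => s t.
by rewrite entry_mkop -natrM mulnb; congr (_%:R).
Qed.

Lemma aux_block_monodromy lam i j :
  aux_block i j (monodromy eta xi lam) = mono (enum 'I_N) lam i j.
Proof.
rewrite /monodromy; elim: (enum _) i j => [|m s ihs] i j.
  by rewrite big_nil aux_block1.
rewrite rev_cons big_mulmx_rcons aux_blockM /= /bmul.
by apply: eq_bigr => l _; rewrite ihs aux_block_R0.
Qed.

Lemma transferE (K : 'M[C]_2) lam : transfer eta xi K lam =
  mono_tr unit_op (R_entry eta) xi K (enum 'I_N) lam.
Proof.
apply: eq_bigr => i _; rewrite aux_blockM; apply: eq_bigr => l _.
rewrite aux_block_monodromy -mul_scalar_mx; congr (_ *m _).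
rewrite -scalemx1 -mkop1 mkopZ; apply: eq_mkop => s t.
by rewrite entry_mkop.
Qed.

Lemma mono_tr_offdiag (K : 'M[C]_2) lam : K ord0 ord0 = 0 -> K ord_max ord_max = 0 ->
  mono_tr unit_op (R_entry eta) xi K (enum 'I_N) lam =
  K ord0 ord_max *: opC eta xi lam + K ord_max ord0 *: opB eta xi lam.
Proof.
move=> K0 K1; rewrite /mono_tr !big_ord_recl !big_ord0 !addr0.
have -> : lift ord0 ord0 = ord_max :> 'I_2 by apply: val_inj.
by rewrite K0 K1 !scale0r add0r addr0 -!aux_block_monodromy.
Qed.

Definition diagz : 'M[C]_2 := diag_mx (\row_i (-1) ^+ (i : 'I_2)).

Lemma sigma_zE (n : 'I_N) : sigma_z n = site_op unit_op n diagz.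
Proof.
rewrite /site_op; under eq_bigr => i _.
  by under eq_bigr do rewrite mkopZ; rewrite mkop_sum; over.
rewrite mkop_sum; apply: eq_mkop => s t.
rewrite (bigD1 (t n)) //= [X in _ + X]big1 ?addr0 => [|a /negbTE am]; last first.
  rewrite big1 // => b _; rewrite !mxE; case: (eqVneq a b) => [<-|_]; last by rewrite mul0r.
  by rewrite eq_sym am mulr0.
rewrite (bigD1 (t n)) //= eqxx big1 ?addr0 => [|b]; last first.
  by rewrite eq_sym => /negbTE ->; rewrite mulr0.
rewrite upd_id !mxE eqxx mulr1n mulrC.
by case: (s =P t) => [->|]; rewrite ?mulr1 ?mulr0.
Qed.

Lemma twistE (kappa : C) i j : twist kappa i j =
  (if i == ord0 then kappa else kappa^-1) * (i != j)%:R.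
Proof. by rewrite /twist mul_diag_mx !mxE. Qed.

Lemma transfer_twist kappa lam : transfer eta xi (twist kappa) lam =
  kappa *: opC eta xi lam + kappa^-1 *: opB eta xi lam.
Proof. by rewrite transferE mono_tr_offdiag !twistE ?eqxx ?mulr0 //= !mulr1. Qed.

Lemma sigma_z_transfer (kappa : C) (n : 'I_N) :
  let G := \big[mulmx/1%:M]_(k <- take n (enum 'I_N))
             transfer eta xi (twist kappa) (xi k) in
  sigma_z n *m (G *m transfer eta xi (twist kappa) (xi n)) =
  G *m (kappa *: opC eta xi (xi n) - kappa^-1 *: opB eta xi (xi n)).
Proof.
move=> G; pose s1 := take n (enum 'I_N); pose s2 := drop n.+1 (enum 'I_N).
have sE : enum 'I_N = s1 ++ n :: s2.
  have nN : (n < size (enum 'I_N))%N by rewrite size_enum_ord.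
  by rewrite -[LHS](cat_take_drop n) (drop_nth n nN) nth_ord_enum.
have us : uniq (s1 ++ n :: s2) by rewrite -sE enum_uniq.
have := inverse_problem unit_op_mul unit_op_comm unit_op_one R_entry0
  R_entry_unitary xi (twist kappa) diagz us.
rewrite /= -sE -sigma_zE /transfer_prod -/s1.
have -> : \big[mulmx/1%:M]_(x <- s1) mono_tr unit_op (R_entry eta) xi
    (twist kappa) (enum 'I_N) (xi x) = G.
  by apply: eq_bigr => x _; rewrite transferE.
rewrite -(transferE (twist kappa)) => ->; congr (_ *m _).
have zkE i j : (diagz *m twist kappa) i j = (-1) ^+ i * twist kappa i j.
  by rewrite mul_diag_mx !mxE.
by rewrite mono_tr_offdiag !zkE !twistE ?eqxx ?mulr0 //= !mulr1 mul1r mulN1r scaleNr.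
Qed.

End TensorModel.

(** * Matrix elements in the SoV bases *)

Section Slots.
Context {R : realType} {N : nat}.
Local Notation C := (R[i]).
Implicit Types (x : 'I_N -> C) (y : C).

Definition setx x (a : 'I_N) y : 'I_N -> C := fun b => if b == a then y else x b.

Lemma eq_vdm x x' : x =1 x' -> vdm x = vdm x'.
Proof. by move=> xx; do 2!apply: eq_bigr => ? _; rewrite !xx. Qed.

(** The constant collects the factors that avoid slot [a] and the signs of the pairs in which [a] is
    the smaller index. It is independent of [y], so it drops out whenever two values of the same
    slot are compared. *)
Lemma vdm_slot x a : exists k, forall y,
  vdm (setx x a y) = k * \prod_(b | b != a) csinh (y - x b).
Proof.
exists ((\prod_(b : 'I_N | (a < b)%N) -1) *
  \prod_(i : 'I_N | i != a) \prod_(j : 'I_N | (i < j)%N && (j != a)) csinh (x j - x i)) => y.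
rewrite /vdm (bigD1 a) //=.
have -> : \prod_(j : 'I_N | (a < j)%N) csinh (setx x a y j - setx x a y a) =
    (\prod_(b : 'I_N | (a < b)%N) -1) * \prod_(b : 'I_N | (a < b)%N) csinh (y - x b).
  rewrite -big_split /=; apply: eq_bigr => j aj; rewrite /setx eqxx.
  by rewrite -[j == a]val_eqE /= gtn_eqF // mulN1r -csinh_subC.
have -> : \prod_(i < N | i != a) \prod_(j < N | (i < j)%N)
      csinh (setx x a y j - setx x a y i) =
    (\prod_(i < N | i != a) if (i < a)%N then csinh (y - x i) else 1) *
    \prod_(i : 'I_N | i != a) \prod_(j : 'I_N | (i < j)%N && (j != a)) csinh (x j - x i).
  rewrite -big_split /=; apply: eq_bigr => i ia.
  rewrite (bigID (fun j => j == a)) /=; congr (_ * _).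
    case: ifP => ltia.
      rewrite (big_pred1 a) => [|j]; first by rewrite /setx eqxx (negbTE ia).
      by rewrite /=; case: (eqVneq j a) => [->|]; rewrite ?andbF ?ltia.
    by rewrite big1 // => j /andP[+ /eqP ja]; rewrite ja ltia.
  by apply: eq_bigr => j /andP[_ ja]; rewrite /setx (negbTE ia) (negbTE ja).
have -> : \prod_(b | b != a) csinh (y - x b) =
    (\prod_(b : 'I_N | (a < b)%N) csinh (y - x b)) *
    \prod_(i < N | i != a) if (i < a)%N then csinh (y - x i) else 1.
  rewrite -[X in _ = _ * X]big_mkcondr.
  rewrite [LHS](bigID (fun b : 'I_N => (a < b)%N)) /=; congr (_ * _);
    apply: eq_bigl => b; rewrite -val_eqE /=; by case: ltngtP.
rewrite -[LHS]mulrA -[RHS]mulrA; congr (_ * _).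
by rewrite [LHS]mulrA [LHS]mulrC.
Qed.

Lemma vdm_neq0 x : (forall i j, i != j -> csinh (x i - x j) != 0) -> vdm x != 0.
Proof.
move=> xD; apply/prodf_neq0 => i _; apply/prodf_neq0 => j ij.
by apply: xD; rewrite -[j == i]val_eqE /= gtn_eqF.
Qed.

Lemma vdm_setx_eq x a b : a != b -> vdm (setx x a (x b)) = 0.
Proof.
move=> ab; have [k ->] := vdm_slot x a.
by rewrite (bigD1 b) 1?eq_sym //= subrr csinh0 mul0r mulr0.
Qed.

Lemma sum_upd (V : nmodType) (a : 'I_N) (i j : 'I_2) (F : config N -> V) :
  \sum_(h : config N | h a == i) F (upd a j h) = \sum_(h : config N | h a == j) F h.
Proof.
rewrite [RHS](reindex_onto (upd a j) (upd a i)) => [|h /eqP <-].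
  apply: eq_bigl => h; rewrite updE eqxx upd_same.
  by apply/eqP/eqP => [<-|hh]; rewrite ?upd_id // -[in LHS]hh updE.
by rewrite upd_same upd_id.
Qed.

(** Multilinearity in the rows: choosing one of two terms in every row is choosing a configuration.
    In this way a sum over SoV labels becomes a single determinant. *)
Lemma det_sum_config (g : 'I_N -> 'I_2 -> 'I_N -> C) :
  \det (\matrix_(m, k) \sum_i g m i k) =
  \sum_(h : config N) \det (\matrix_(m, k) g m (h m) k).
Proof.
rewrite /determinant exchange_big /=; apply: eq_bigr => s _.
rewrite -mulr_sumr; congr (_ * _).
under eq_bigr do rewrite mxE; rewrite bigA_distr_bigA /=.
by apply: eq_bigr => h _; apply: eq_bigr => m _; rewrite mxE.
Qed.

End Slots.

Section SoVElements.
Context {R : realType} {N : nat}.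
Local Notation C := (R[i]).
Variables (eta : C) (xi : 'I_N -> C).
Hypothesis xi_neq : forall a b, a != b ->
  [/\ csinh (xi a - xi b) != 0, csinh (xi a - xi b + eta) != 0
    & csinh (xi a - xi b - eta) != 0].
Variables (bra : config N -> 'rV[C]_#|config N|) (ket : config N -> 'cV[C]_#|config N|).
Hypothesis bases : SoV_bases eta xi bra ket.

Definition sites (h : config N) (m : 'I_N) : C := xi_h eta xi (h m) m.
Definition cosites (h : config N) (m : 'I_N) : C := xi_h eta xi (1 - h m) m.
Definition dxi (a : 'I_N) : C := \prod_(b | b != a) csinh (xi a - xi b).

Lemma dxi_neq0 a : dxi a != 0.
Proof. by apply/prodf_neq0 => b ba; case: (@xi_neq a b) => //; rewrite eq_sym. Qed.

Lemma vdm_sites_neq0 h : vdm (sites h) != 0.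
Proof.
apply: vdm_neq0 => i j ij; have [d0 d1 d2] := xi_neq ij.
rewrite /sites /xi_h; case: (h i) (h j) => [[|[|//]] ?] [[|[|//]] ?] /=.
- by rewrite !mul0r !subr0.
- by rewrite mul0r mul1r subr0 opprB addrA addrAC.
- by rewrite mul0r mul1r subr0 addrAC.
- by rewrite !mul1r opprB addrA subrK.
Qed.

Lemma vdm_xi_neq0 : vdm xi != 0.
Proof. by apply: vdm_neq0 => i j /xi_neq[]. Qed.

Variables (wP wQ : 'I_N -> C).

Definition lvec : 'rV[C]_#|config N| :=
  \sum_(h : config N) ((\prod_m wP m ^+ (1 - h m)) * vdm (sites h)) *: bra h.
Definition rvec : 'cV[C]_#|config N| :=
  \sum_(h : config N) ((\prod_m wQ m ^+ (1 - h m)) * (vdm (cosites h) / vdm xi)) *: ket h.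

(* The part [h n = 1] of the scalar product, with the n-th argument of the
   Vandermonde product moved to [y]. *)
Definition Zsum (n : 'I_N) (y : C) : C :=
  \sum_(h : config N | h n == ord_max)
    (\prod_m (wP m * wQ m) ^+ (1 - h m)) * vdm (setx (cosites h) n y).

Lemma pairingZl c (v : 'rV[C]_#|config N|) w : pairing (c *: v) w = c * pairing v w.
Proof. by rewrite /pairing -scalemxAl mxE. Qed.

Lemma pairing_suml (I : finType) (P : pred I) (F : I -> 'rV[C]_#|config N|)
    (w : 'cV[C]_#|config N|) :
  pairing (\sum_(i | P i) F i) w = \sum_(i | P i) pairing (F i) w.
Proof. by rewrite /pairing mulmx_suml summxE. Qed.

Lemma pairing_bra_rvec h : pairing (bra h) rvec =
  (\prod_m wQ m ^+ (1 - h m)) * (vdm (cosites h) / vdm xi) / vdm (sites h).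
Proof.
rewrite /pairing /rvec mulmx_sumr summxE (bigD1 h) //= [X in _ + X]big1 ?addr0 => [|k kh].
  by rewrite -scalemxAr mxE -/(pairing _ _) (bra_ket bases) eqxx mul1r.
rewrite -scalemxAr mxE -/(pairing _ _) (bra_ket bases) eq_sym (negbTE kh).
by rewrite mul0r mulr0.
Qed.

Lemma pairing_lr : vdm xi * pairing lvec rvec =
  \sum_(h : config N) (\prod_m (wP m * wQ m) ^+ (1 - h m)) * vdm (cosites h).
Proof.
rewrite pairing_suml mulr_sumr; apply: eq_bigr => h _.
rewrite pairingZl pairing_bra_rvec.
under [in RHS]eq_bigr do rewrite exprMn.
rewrite big_split /=; have := vdm_sites_neq0 h; have := vdm_xi_neq0.
move: (vdm (sites h)) (vdm (cosites h)) (vdm xi) => x y z z0 x0.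
by field; rewrite x0 z0.
Qed.

Lemma cosites_setx n h : vdm (cosites h) = vdm (setx (cosites h) n (cosites h n)).
Proof. by apply: eq_vdm => b; rewrite /setx; case: eqP => [->|]. Qed.

(** The label [h n = 1] puts [xi n] into slot [n], and [h n = 0] puts [xi n - eta] there; flipping
    the label reindexes the second half at the cost of the weight of site [n]. *)
Lemma Zsum_split n : vdm xi * pairing lvec rvec =
  Zsum n (xi n) + wP n * wQ n * Zsum n (xi n - eta).
Proof.
rewrite pairing_lr (bigID (fun h : config N => h n == ord_max)) /=; congr (_ + _).
  apply: eq_bigr => h /eqP hn; rewrite (cosites_setx n) /cosites hn /xi_h /=.
  by rewrite mul0r subr0.
rewrite mulr_sumr.
transitivity (\sum_(h : config N | h n == ord0)
    (\prod_m (wP m * wQ m) ^+ (1 - h m)) * vdm (cosites h)).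
  by apply: eq_bigl => h; rewrite -val_eqE /=; case: (h n) => [[|[|//]] ?].
rewrite -(@sum_upd _ _ n ord_max ord0); apply: eq_bigr => h /eqP hn.
rewrite mulrA (bigD1 n) //= updE expr1; congr (_ * _ * _).
  rewrite [RHS](bigD1 n) //= hn expr0 mul1r; apply: eq_bigr => m mn.
  by rewrite ffunE (negbTE mn).
rewrite (cosites_setx n); apply: eq_vdm => b; rewrite /setx.
case: eqP => [_|/eqP bn]; first by rewrite /cosites updE /xi_h mul1r.
by rewrite /cosites ffunE (negbTE bn).
Qed.

Lemma prod_but2 (F : 'I_N -> C) (a n : 'I_N) : a != n ->
  \prod_(b | b != a) F b = F n * \prod_(b | (b != a) && (b != n)) F b.
Proof. by move=> an; rewrite (bigD1 n) // eq_sym. Qed.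

(** The denominators of [sov_coef] are the factors of the Vandermonde product in slot [a], up to the
    same constant: the coefficient is a Lagrange factor that moves this slot to [lam]. *)
Lemma sov_slot (a : 'I_N) (h : config N) lam : h a = ord_max ->
  vdm (sites h) * sov_coef eta xi lam h a = vdm (setx (sites (upd a ord0 h)) a lam).
Proof.
move=> ha; have [k kE] := vdm_slot (sites h) a.
have -> : vdm (setx (sites (upd a ord0 h)) a lam) = vdm (setx (sites h) a lam).
  apply: eq_vdm => b; rewrite /setx /sites; case: eqP => // /eqP ba.
  by rewrite ffunE (negbTE ba).
have -> : vdm (sites h) = vdm (setx (sites h) a (sites h a)).
  by apply: eq_vdm => b; rewrite /setx; case: eqP => [->|].
rewrite !kE -mulrA -[X in _ * X]big_split /=; congr (_ * _); apply: eq_bigr => b ba.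
rewrite [LHS]mulrC divfK // /sites ha /xi_h mul1r.
have ab : a != b by rewrite eq_sym.
have [d0 d1 d2] := xi_neq ab.
case: (h b) => [[|[|//]] ?] /=; first by rewrite mul0r subr0 addrAC.
by rewrite mul1r opprB addrA subrK.
Qed.

(** The action of B moves [xi n] into slot [a] of the Vandermonde product of [sites]. The identity
    transfers this to the product of [cosites], with [xi a] in slot [n], which is the form summed in
    [Zsum]. *)
Lemma sov_vdm (a n : 'I_N) (h : config N) : a != n -> h a = ord_max -> h n = ord_max ->
  let k := upd a ord0 h in
  vdm (sites h) * sov_coef eta xi (xi n) h a * a_fun eta xi (xi a) *
     (vdm (cosites k) / vdm (sites k)) =
  - (a_fun eta xi (xi n) * (dxi n / dxi a)) * vdm (setx (cosites k) n (xi a)).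
Proof.
move=> an ha hn k; have kD b : b != a -> k b = h b by move=> ba; rewrite ffunE (negbTE ba).
have ka : k a = ord0 by rewrite updE.
have kn : k n = ord_max by rewrite kD // eq_sym.
have [K1 K1E] := vdm_slot (sites k) a.
have [K2 K2E] := vdm_slot (cosites k) n.
have := vdm_sites_neq0 k.
have -> : vdm (sites k) = K1 * \prod_(b | b != a) csinh (xi a - sites k b).
  rewrite -K1E; apply: eq_vdm => b; rewrite /setx /sites; case: eqP => [->|//].
  by rewrite ka /xi_h mul0r subr0.
have -> : vdm (cosites k) = K2 * \prod_(b | b != n) csinh (xi n - cosites k b).
  rewrite -K2E; apply: eq_vdm => b; rewrite /setx; case: eqP => [->|//].
  by rewrite /cosites kn /xi_h mul0r subr0.
rewrite K2E sov_slot // K1E.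
have key : (\prod_(b | b != a) csinh (xi n - sites k b)) * a_fun eta xi (xi a) *
    (\prod_(b | b != n) csinh (xi n - cosites k b)) * dxi a =
    - (a_fun eta xi (xi n) * dxi n *
       (\prod_(b | b != n) csinh (xi a - cosites k b)) *
       \prod_(b | b != a) csinh (xi a - sites k b)).
  have an' : n != a by rewrite eq_sym.
  have aE m b : m != b -> a_fun eta xi (xi m) = csinh eta *
      (csinh (xi m - xi b + eta) *
       \prod_(l | (l != m) && (l != b)) csinh (xi m - xi l + eta)).
    move=> mb; rewrite -(prod_but2 (fun l => csinh (xi m - xi l + eta)) mb).
    by rewrite /a_fun (bigD1 m) //= subrr add0r.
  rewrite !(aE a n) // !(aE n a) // /dxi !(prod_but2 _ an) !(prod_but2 _ an').
  have -> : sites k n = xi n - eta by rewrite /sites kn /xi_h mul1r.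
  have -> : cosites k a = xi a - eta by rewrite /cosites ka /xi_h mul1r.
  have swapP F : \prod_(b | (b != n) && (b != a)) F b =
      \prod_(b | (b != a) && (b != n)) F b :> C by apply: eq_bigl => b; rewrite andbC.
  rewrite !swapP.
  have -> : xi n - (xi n - eta) = eta by ring.
  have -> : xi a - (xi a - eta) = eta by ring.
  have -> : xi a - (xi n - eta) = xi a - xi n + eta by ring.
  have -> : xi n - (xi a - eta) = xi n - xi a + eta by ring.
  rewrite [csinh (xi a - xi n)]csinh_subC.
  pose P F : C := \prod_(b | (b != a) && (b != n)) F b.
  (* At every other site [b], [sites k b] and [cosites k b] are [xi b] and [xi b - eta] in some
     order, so the product of their two sinh factors does not depend on the label. *)
  have prodE : P (fun b => csinh (xi n - sites k b)) * P (fun l => csinh (xi a - xi l + eta)) *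
      P (fun b => csinh (xi n - cosites k b)) * P (fun b => csinh (xi a - xi b)) =
      P (fun l => csinh (xi n - xi l + eta)) * P (fun b => csinh (xi n - xi b)) *
      P (fun b => csinh (xi a - cosites k b)) * P (fun b => csinh (xi a - sites k b)).
    rewrite /P -!big_split /=; apply: eq_bigr => b _; rewrite /sites /cosites /xi_h.
    case: (k b) => [[|[|//]] ?] /=; rewrite mul0r mul1r !subr0 !opprB ![_ + (eta - _)]addrCA.
      rewrite ![eta + _]addrC; move: (csinh _) (csinh _) (csinh _) (csinh _) => x y z t.
      by ring.
    rewrite ![eta + _]addrC; move: (csinh _) (csinh _) (csinh _) (csinh _) => x y z t.
    by ring.
  move: prodE; rewrite /P; move: (\prod_(b | _) _) (\prod_(b | _) _) (\prod_(b | _) _)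
    (\prod_(b | _) _) (\prod_(b | _) _) (\prod_(b | _) _) (\prod_(b | _) _)
    (\prod_(b | _) _) => P8 P7 P6 P5 P4 P3 P2 P1.
  move: (csinh eta) (csinh _) (csinh _) (csinh _) => e c1 c2 c3 PE.
  transitivity (- (c3 * c3 * c1 * c2 * csinh (xi n - xi a)) * (P1 * P2 * P3 * P4)).
    by move: (csinh _) => c4; ring.
  by rewrite PE; move: (csinh _) => c4; ring.
have := dxi_neq0 a; rewrite mulf_eq0 negb_or => da /andP[K10 X0].
move: key; move: (a_fun _ _ (xi a)) (a_fun _ _ (xi n)) (dxi n) (dxi a) da
  (\prod_(b | b != a) csinh (xi a - sites k b)) X0
  (\prod_(b | b != a) csinh (xi n - sites k b))
  (\prod_(b | b != n) csinh (xi n - cosites k b))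
  (\prod_(b | b != n) csinh (xi a - cosites k b)).
move=> Aa An dn da da0 X X0 U Y Y' key.
transitivity (K2 * (U * Aa * Y * da) / (X * da)); first by field; rewrite X0 K10 da0.
by rewrite key; field; rewrite X0 da0.
Qed.

Lemma opB_element n : (forall a, wP a != 0) ->
  vdm xi * pairing (lvec *m opB eta xi (xi n)) rvec =
  - (a_fun eta xi (xi n) * wQ n * Zsum n (xi n - eta)) +
  \sum_(a | a != n) a_fun eta xi (xi n) * (dxi n / dxi a) / wP a * Zsum n (xi a).
Proof.
move=> wP0.
have lowerE (a : 'I_N) (h : config N) : h a = ord_max -> lower a h = upd a ord0 h.
  move=> ha; apply/ffunP => b; rewrite !ffunE; case: eqP => // ->.
  by rewrite ha; apply: val_inj; rewrite /= inordK.
pose T a := \sum_(h : config N | h a == ord_max)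
  ((\prod_m wP m ^+ (1 - h m)) * (\prod_m wQ m ^+ (1 - upd a ord0 h m))) *
  (vdm (sites h) * sov_coef eta xi (xi n) h a * a_fun eta xi (xi a) *
    (vdm (cosites (upd a ord0 h)) / vdm (sites (upd a ord0 h)))).
have -> : vdm xi * pairing (lvec *m opB eta xi (xi n)) rvec = - \sum_a T a.
  transitivity (- (vdm xi * \sum_(h : config N) \sum_a
     ((\prod_m wP m ^+ (1 - h m)) * vdm (sites h)) *
     ((sov_coef eta xi (xi n) h a * (h a == 1%N :> nat)%:R * a_fun eta xi (xi_h eta xi 0 a)) *
       pairing (bra (lower a h)) rvec))).
    rewrite -mulrN; congr (_ * _); rewrite /lvec mulmx_suml pairing_suml -sumrN.
    apply: eq_bigr => h _; rewrite -scalemxAl (bra_B bases) pairingZl.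
    rewrite /pairing mulNmx mxE -/(pairing _ _) pairing_suml mulrN mulr_sumr.
    by congr (- _); apply: eq_bigr => a _; rewrite pairingZl.
  congr (- _); rewrite exchange_big /= mulr_sumr; apply: eq_bigr => a _.
  rewrite mulr_sumr [RHS]big_mkcond /=; apply: eq_bigr => h _.
  case: (h a =P ord_max) => [ha|hna]; last first.
    rewrite (_ : (h a == 1%N :> nat) = false) ?mulr0 ?mul0r ?mulr0 //.
    by apply/negP => /eqP h1; apply: hna; apply: val_inj.
  rewrite lowerE // ha eqxx mulr1 pairing_bra_rvec /xi_h mul0r subr0.
  have := vdm_xi_neq0; have := vdm_sites_neq0 (upd a ord0 h).
  move: (\prod_m _) (\prod_m _) (vdm (sites _)) (vdm (sites _)) (vdm xi) => p r x y z y0 z0.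
  move: (sov_coef _ _ _ _ _) (a_fun _ _ _) (vdm _) => S A V.
  by field; rewrite y0 z0.
have prodE (a : 'I_N) (h : config N) : h a = ord_max ->
    (\prod_m wP m ^+ (1 - h m)) * (\prod_m wQ m ^+ (1 - upd a ord0 h m)) =
    wQ a * \prod_m (wP m * wQ m) ^+ (1 - h m).
  move=> ha; rewrite -big_split /= (bigD1 a) //= [in RHS](bigD1 a) //= updE ha.
  rewrite !expr0 !mul1r expr1; congr (_ * _); apply: eq_bigr => b ba.
  by rewrite ffunE (negbTE ba) -exprMn.
have prodE' (a : 'I_N) (h : config N) : h a = ord_max ->
    wQ a * \prod_m (wP m * wQ m) ^+ (1 - h m) =
    (wP a)^-1 * \prod_m (wP m * wQ m) ^+ (1 - upd a ord0 h m).
  move=> ha; rewrite (bigD1 a) //= [in RHS](bigD1 a) //= updE ha expr0 mul1r expr1.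
  rewrite !mulrA mulVf // mul1r; congr (_ * _); apply: eq_bigr => b ba.
  by rewrite ffunE (negbTE ba).
rewrite (bigD1 n) //= opprD -[X in _ + X = _]sumrN; congr (- _ + _).
  rewrite mulr_sumr; apply: eq_bigr => h /eqP hn; rewrite prodE // sov_slot //.
  have -> : vdm (setx (sites (upd n ord0 h)) n (xi n)) = vdm (sites (upd n ord0 h)).
    apply: eq_vdm => b; rewrite /setx; case: eqP => // ->.
    by rewrite /sites updE /xi_h mul0r subr0.
  have -> : vdm (cosites (upd n ord0 h)) = vdm (setx (cosites h) n (xi n - eta)).
    apply: eq_vdm => b; rewrite /setx; case: eqP => [->|/eqP bn].
      by rewrite /cosites updE /xi_h mul1r.
    by rewrite /cosites ffunE (negbTE bn).
  have := vdm_sites_neq0 (upd n ord0 h).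
  move: (vdm _) (vdm _) (a_fun _ _ _) (\prod_m _) => x y A p y0.
  by field.
apply: eq_bigr => a an.
transitivity (\sum_(h : config N | (h a == ord_max) && (h n == ord_max))
    a_fun eta xi (xi n) * (dxi n / dxi a) / wP a *
    ((\prod_m (wP m * wQ m) ^+ (1 - upd a ord0 h m)) *
     vdm (setx (cosites (upd a ord0 h)) n (xi a)))).
  rewrite /T -sumrN [LHS](bigID (fun h : config N => h n == ord_max)) /=.
  rewrite [X in _ + X]big1 ?addr0 => [|h /andP[/eqP ha hn]]; last first.
    have hn0 : h n = ord0 by apply: val_inj; case: (h n) hn => [[|[|//]] ?].
    (* With [h n = 0] the site [n] sits exactly at the spectral parameter [xi n], which makes one
       factor vanish. *)
    have -> : sov_coef eta xi (xi n) h a = 0.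
      by rewrite /sov_coef (bigD1 n) 1?eq_sym //= hn0 /xi_h mul0r subr0 subrr csinh0 !mul0r.
    by rewrite mulr0 mul0r mul0r mulr0 oppr0.
  apply: eq_bigr => h /andP[/eqP ha /eqP hn]; rewrite prodE // prodE' // sov_vdm //.
  move: (vdm _) (\prod_m _) (a_fun _ _ _) (_ / dxi a) => x y A D.
  by ring.
rewrite -mulr_sumr; congr (_ * _).
pose F (h : config N) := if h n == ord_max then
  (\prod_m (wP m * wQ m) ^+ (1 - h m)) * vdm (setx (cosites h) n (xi a)) else 0.
transitivity (\sum_(h : config N | h a == ord_max) F (upd a ord0 h)).
  by rewrite big_mkcondr /=; apply: eq_bigr => h _; rewrite /F ffunE [n == a]eq_sym (negbTE an).
rewrite sum_upd /Zsum [RHS]big_mkcond /= -/F [RHS](bigID (fun h : config N => h a == ord0)) /=.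
rewrite [X in _ = _ + X]big1 ?addr0 // => h ha; case: ifP => // _.
have -> : xi a = cosites h a.
  rewrite /cosites /xi_h; case: (h a) ha => [[|[|//]] ?] //= _.
  by rewrite mul0r subr0.
by rewrite vdm_setx_eq ?mulr0 // eq_sym.
Qed.

End SoVElements.

(** * Partial fractions and the Cauchy determinant for sinh *)

Section PartialFractions.
Context {R : realType}.
Local Notation C := (R[i]).
Implicit Types (x y : C).

Lemma expoly_partial_fraction (d : nat) (t : 'I_d.+1 -> C) (f : C -> C) y :
  (forall i j, i != j -> csinh (t i - t j) != 0) -> expoly 1 d f ->
  (forall i, csinh (y - t i) != 0) ->
  f y / \prod_i csinh (y - t i) =
  \sum_i f (t i) / ((\prod_(l | l != i) csinh (t i - t l)) * csinh (y - t i)).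
Proof.
move=> tD fd yt; rewrite (expoly_lagrange y tD fd) mulr_suml; apply: eq_bigr => i _.
rewrite prodf_div [X in _ / X = _](bigD1 i) //=.
have : \prod_(l | l != i) csinh (t i - t l) != 0.
  by apply/prodf_neq0 => l li; apply: tD; rewrite eq_sym.
have : \prod_(l | l != i) csinh (y - t l) != 0 by apply/prodf_neq0 => l _.
have := yt i; move: (csinh (y - t i)) (\prod_(l | _) _) (\prod_(l | _) _) => a b c a0 b0 c0.
by field; rewrite a0 b0 c0.
Qed.

Lemma expoly_partial_fraction_extra (d : nat) (t : 'I_d.+1 -> C) (f : C -> C) x y :
  (forall i j, i != j -> csinh (t i - t j) != 0) -> expoly 1 d.+1 f ->
  (forall i, csinh (y - t i) != 0) -> (forall i, csinh (x - t i) != 0) ->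
  csinh (y - x) != 0 ->
  f y / (csinh (y - x) * \prod_i csinh (y - t i)) =
  f x / ((\prod_i csinh (x - t i)) * csinh (y - x)) +
  \sum_i f (t i) / (csinh (t i - x) *
     (\prod_(l | l != i) csinh (t i - t l)) * csinh (y - t i)).
Proof.
move=> tD fd yt xt yx.
(* Taking the extra pole [x] as an additional node makes room for a numerator of degree one
   higher. *)
pose t' (i : 'I_d.+2) := if unlift ord0 i is Some j then t j else x.
have t'0 : t' ord0 = x by rewrite /t' unlift_none.
have t'S j : t' (lift ord0 j) = t j by rewrite /t' liftK.
have t'D i j : i != j -> csinh (t' i - t' j) != 0.
  case: (unliftP ord0 i) (unliftP ord0 j) => [i' ->|->] [j' ->|->] ij; rewrite ?t'0 ?t'S.
  - by apply: tD; apply: contra_neq ij => ->.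
  - by rewrite csinh_subC oppr_eq0.
  - exact: xt.
  - by rewrite eqxx in ij.
have yt' i : csinh (y - t' i) != 0.
  by case: (unliftP ord0 i) => [i' ->|->]; rewrite ?t'0 ?t'S.
have P0 : \prod_(l | l != ord0) csinh (t' ord0 - t' l) = \prod_i csinh (x - t i).
  rewrite big_mkcond big_ord_recl eqxx /= mul1r; apply: eq_bigr => i _.
  by rewrite t'0 t'S.
have PS j : \prod_(l | l != lift ord0 j) csinh (t' (lift ord0 j) - t' l) =
    csinh (t j - x) * \prod_(l | l != j) csinh (t j - t l).
  rewrite big_mkcond big_ord_recl t'S t'0; congr (_ * _).
  rewrite [RHS]big_mkcond; apply: eq_bigr => i _.
  by rewrite (inj_eq lift_inj) t'S.
have := expoly_partial_fraction t'D fd yt'.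
have -> : \prod_i csinh (y - t' i) = csinh (y - x) * \prod_i csinh (y - t i).
  by rewrite big_ord_recl t'0; congr (_ * _); apply: eq_bigr => i _; rewrite t'S.
rewrite [X in _ = X]big_ord_recl P0 t'0 => ->; congr (_ + _).
by apply: eq_bigr => i _; rewrite PS t'S.
Qed.

Lemma prod_neq_pair (N : nat) (T : comRingType) (F : 'I_N -> 'I_N -> T) :
  \prod_k \prod_(l | l != k) F k l =
  \prod_(i < N) \prod_(j < N | (i < j)%N) (F i j * F j i).
Proof.
rewrite [RHS](eq_bigr (fun i : 'I_N => (\prod_(j < N | (i < j)%N) F i j) *
    \prod_(j < N | (i < j)%N) F j i)) => [|i _]; last by rewrite -big_split.
rewrite big_split /= [X in _ = _ * X](exchange_big_dep xpredT) //= -big_split /=.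
apply: eq_bigr => k _; rewrite (bigID (fun l : 'I_N => (k < l)%N)) /=.
by congr (_ * _); apply: eq_bigl => l; rewrite -val_eqE /=; case: ltngtP.
Qed.

Lemma det_cauchy_csinh (d : nat) (x t : 'I_d.+1 -> C) :
  (forall i j, i != j -> csinh (t i - t j) != 0) ->
  (forall i j, csinh (x i - t j) != 0) ->
  \det (\matrix_(i, j) (csinh (x i - t j))^-1) *
    \prod_i \prod_j csinh (x i - t j) =
  vdm x * \prod_(i < d.+1) \prod_(j < d.+1 | (i < j)%N) csinh (t i - t j).
Proof.
move=> tD xt; pose u k y := \prod_(l | l != k) csinh (y - t l).
have [c cE] := det_expoly (fun k => expoly_prod_csinh_but k t).
have vt : vdm t != 0 by apply: vdm_neq0.
(* The constant is found by evaluating at the nodes [t] themselves, where the matrix is diagonal. *)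
have cV : c = \prod_(i < d.+1) \prod_(j < d.+1 | (i < j)%N) csinh (t i - t j).
  apply: (mulIf vt); rewrite -cE.
  have -> : \matrix_(m, k) \prod_(l | l != k) csinh (t m - t l) =
      diag_mx (\row_k u k (t k)).
    apply/matrixP => m k; rewrite !mxE; case: (eqVneq m k) => [->|mk].
      by rewrite mulr1n.
    by rewrite mulr0n (bigD1 m) //= subrr csinh0 mul0r.
  rewrite det_diag; under eq_bigr do rewrite mxE.
  by rewrite /u prod_neq_pair -big_split /=; apply: eq_bigr => i _; rewrite -big_split.
rewrite [RHS]mulrC -cV -cE.
have -> : \matrix_(m, k) \prod_(l | l != k) csinh (x m - t l) =
    diag_mx (\row_i \prod_j csinh (x i - t j)) *m \matrix_(i, j) (csinh (x i - t j))^-1.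
  apply/matrixP => m k; rewrite mul_diag_mx !mxE [X in _ = X / _](bigD1 k) //=.
  by rewrite mulrC mulrA mulVf ?mul1r.
by rewrite det_mulmx det_diag mulrC; under [in RHS]eq_bigr do rewrite mxE.
Qed.

End PartialFractions.

Section TrigPoly.
Context {R : realType} {N : nat}.
Local Notation C := (R[i]).
Implicit Types (eta x : C) (xi p : 'I_N -> C).

Lemma d_fun_ipi xi x : d_fun xi (x + ipi) = (-1) ^+ N * d_fun xi x.
Proof.
rewrite /d_fun -[N in (-1) ^+ N]card_ord -prodrN; apply: eq_bigr => i _.
by rewrite addrAC csinh_ipi.
Qed.

Lemma a_funE eta xi x : a_fun eta xi x = d_fun xi (x + eta).
Proof. by apply: eq_bigr => i _; rewrite addrAC. Qed.

Lemma a_fun_ipi eta xi x : a_fun eta xi (x + ipi) = (-1) ^+ N * a_fun eta xi x.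
Proof. by rewrite !a_funE addrAC d_fun_ipi. Qed.

Lemma d_fun_xi xi m : d_fun xi (xi m) = 0.
Proof. by rewrite /d_fun (bigD1 m) //= subrr csinh0 mul0r. Qed.

Lemma tpoly_2ipi p x : tpoly p (x + ipi + ipi) = (-1) ^+ N * tpoly p x.
Proof.
rewrite /tpoly -[N in (-1) ^+ N]card_ord -prodrN; apply: eq_bigr => i _.
rewrite -csinh_half_ipi2; congr csinh; congr (_ / _); ring.
Qed.

(** The shift by [i pi] turns a half-argument sinh into [e^(i pi / 2)] times a cosh, and the two
    combine into a sinh of the full argument. The resulting constant cancels wherever it appears. *)
Lemma tpolyM_ipi p x : tpoly p x * tpoly p (x + ipi) =
  (\prod_(j < N) (cexp (ipi / 2) / 2)) * \prod_j csinh (x - p j).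
Proof.
rewrite /tpoly -!big_split /=; apply: eq_bigr => j _.
rewrite addrAC csinh_half_ipi (csinh_double (x - p j)).
move: (csinh _) (ccosh _) (cexp _) => a b c; by field.
Qed.

Lemma tpoly_root p k : tpoly p (p k) = 0.
Proof. by rewrite /tpoly (bigD1 k) //= subrr mul0r csinh0 mul0r. Qed.

Lemma tpoly_expoly p : expoly 2^-1 N (tpoly p).
Proof.
have : expoly 2^-1 (\sum_(j < N) 1) (tpoly p).
  by apply: expoly_prod => j _; apply: expoly_csinh_half.
by rewrite sum1_card card_ord.
Qed.

End TrigPoly.

(** * Generic inhomogeneities and the TQ equation at these points *)

Section Inhomogeneities.
Context {R : realType} {N : nat}.
Local Notation C := (R[i]).
Variables (eta : C) (xi : 'I_N -> C).
Hypothesis heta : ~ commensurate eta ipi.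
Hypothesis hXi : forall i j : 'I_N, i != j -> Xi eta xi i `&` Xi eta xi j = set0.

(** The booleans encode the two values 0 and -1 of the multiple of [eta], so one statement covers
    the differences shifted by 0, [eta] and [- eta]. *)
Lemma Xi_disjoint i j (a b : bool) (k : int) : i != j ->
  xi i - a%:R * eta <> xi j - b%:R * eta + k%:~R * ipi.
Proof.
move=> ij E; have : (Xi eta xi i `&` Xi eta xi j) (xi i - a%:R * eta).
  split; [exists (- (a : nat)%:Z), 0|exists (- (b : nat)%:Z), k].
    by split; [case: a E => _; [right|left]|rewrite mul0r addr0 mulrNz mulNr -pmulrn].
  by split; [case: b E => _; [right|left]|rewrite mulrNz mulNr -pmulrn].
by rewrite hXi.
Qed.

Lemma Xi_csinh i j : i != j ->
  [/\ csinh (xi i - xi j) != 0, csinh (xi i - xi j + eta) != 0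
    & csinh (xi i - xi j - eta) != 0].
Proof.
move=> ij; split; apply/eqP => /csinh_eq0[k kE].
- apply: (@Xi_disjoint i j false false k ij); rewrite -kE /=; ring.
- apply: (@Xi_disjoint i j false true k ij); rewrite -kE /=; ring.
- apply: (@Xi_disjoint i j true false k ij); rewrite -kE /=; ring.
Qed.

Lemma a_fun_xi_neq0 m : a_fun eta xi (xi m) != 0.
Proof.
apply/prodf_neq0 => j _; case: (eqVneq m j) => [->|mj]; last by case: (Xi_csinh mj).
by rewrite subrr add0r csinh_incommensurate.
Qed.

Variables (p : 'I_N -> C) (tau : C -> C).
Hypothesis TQ : TQ_solution eta xi (tpoly p) tau.

Lemma TQ_xi m :
  tau (xi m) * tpoly p (xi m) = - (a_fun eta xi (xi m) * tpoly p (xi m - eta)).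
Proof. by rewrite (TQ_eq TQ) d_fun_xi mul0r addr0. Qed.

(** Under [i pi], [tau] picks up [(-1)^(N-1)] and [a_fun] picks up [(-1)^N], whence the sign
    opposite to [TQ_xi]. The two relations together express the characterization of [P] by its
    ratios at [xi m] and [xi m + i pi]. *)
Lemma TQ_xi_ipi m : tau (xi m) * tpoly p (xi m + ipi) =
  a_fun eta xi (xi m) * tpoly p (xi m - eta + ipi).
Proof.
have := TQ_eq TQ (xi m + ipi); rewrite (TQ_periodic TQ) d_fun_ipi d_fun_xi.
rewrite mulr0 mul0r addr0 a_fun_ipi [_ + ipi - eta]addrAC.
have -> : (-1) ^+ N = - (-1) ^+ (N - 1) :> C.
  have N0 : (0 < N)%N by rewrite (leq_ltn_trans _ (ltn_ord m)).
  by rewrite -[N in LHS](prednK N0) exprS mulN1r subn1.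
rewrite !mulNr opprK -!mulrA; apply: mulfI.
by rewrite signr_eq0.
Qed.

Hypothesis hden : forall m, tpoly p (xi m - eta) != 0.

Lemma TQ_tau_neq0 m : tau (xi m) != 0.
Proof.
apply/eqP => t0; have := TQ_xi m; rewrite t0 mul0r => /esym/eqP.
by rewrite oppr_eq0 mulf_eq0 (negbTE (hden m)) (negbTE (a_fun_xi_neq0 m)).
Qed.

Lemma TQ_tpoly_neq0 m : tpoly p (xi m) != 0.
Proof.
apply/eqP => t0; have := TQ_xi m; rewrite t0 mulr0 => /esym/eqP.
by rewrite oppr_eq0 mulf_eq0 (negbTE (hden m)) (negbTE (a_fun_xi_neq0 m)).
Qed.

Lemma TQ_ratio m : tpoly p (xi m) / tpoly p (xi m - eta) =
  - (a_fun eta xi (xi m) / tau (xi m)).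
Proof.
have := TQ_xi m; have := TQ_tau_neq0 m; have := hden m.
move: (tpoly p (xi m)) (tpoly p (xi m - eta)) (a_fun _ _ _) (tau _) => y x a t x0 t0 E.
have -> : y = - (a * x) / t by rewrite -E mulrAC divff // mul1r.
by field; rewrite x0 t0.
Qed.

End Inhomogeneities.

(** * Reduction of the form factor to values of [Zsum] *)

Section FormFactor.
Context {R : realType} {N : nat}.
Local Notation C := (R[i]).
Variables (eta : C) (xi : 'I_N -> C).
Hypothesis heta : ~ commensurate eta ipi.
Hypothesis hXi : forall i j : 'I_N, i != j -> Xi eta xi i `&` Xi eta xi j = set0.
Variables (bra : config N -> 'rV[C]_#|config N|) (ket : config N -> 'cV[C]_#|config N|).
Hypothesis bases : SoV_bases eta xi bra ket.
Variables (kappa eps : C).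
Hypotheses (hkappa : kappa != 0) (heps : eps = 1 \/ eps = -1).
Variables (n : 'I_N) (p q : 'I_N -> C) (tauP tauQ : C -> C).
Hypothesis hPden : forall m, tpoly p (xi m - eta) != 0.
Hypothesis hQden : forall m, tpoly q (xi m - eta) != 0.
Hypothesis hP : left_eigenstate eta xi bra p tauP kappa eps.
Hypothesis hQ : right_eigenstate eta xi ket q tauQ kappa eps.

Let L := left_sep eta xi bra (tpoly p) kappa eps.
Let V := right_sep eta xi ket (tpoly q) kappa eps.
Let wP m : C := eps / kappa * (tpoly p (xi m) / tpoly p (xi m - eta)).
Let wQ m : C := eps * kappa * (tpoly q (xi m) / tpoly q (xi m - eta)).
Let Z := Zsum eta xi wP wQ n.
Let A m := a_fun eta xi (xi m).

Lemma eigen_prod_left (I : Type) (s : seq I) (T : I -> 'M[C]_#|config N|)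
    (v : 'rV[C]_#|config N|) (t : I -> C) :
  (forall k, v *m T k = t k *: v) ->
  v *m (\big[mulmx/1%:M]_(k <- s) T k) = (\prod_(k <- s) t k) *: v.
Proof.
move=> vT; elim: s => [|k s ihs]; first by rewrite !big_nil mulmx1 scale1r.
by rewrite !big_cons mulmxA vT -scalemxAl ihs scalerA.
Qed.

Lemma eigen_prod_right (I : Type) (s : seq I) (T : I -> 'M[C]_#|config N|)
    (v : 'cV[C]_#|config N|) (t : I -> C) :
  (forall k, T k *m v = t k *: v) ->
  (\big[mulmx/1%:M]_(k <- s) T k) *m v = (\prod_(k <- s) t k) *: v.
Proof.
move=> vT; elim: s => [|k s ihs]; first by rewrite !big_nil mul1mx scale1r.
by rewrite !big_cons -mulmxA ihs -scalemxAr vT scalerA mulrC.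
Qed.

Lemma prod_leq_take (F : 'I_N -> C) :
  \prod_(k < N | (k <= n)%N) F k = (\prod_(k <- take n (enum 'I_N)) F k) * F n.
Proof.
rewrite -[RHS]big_rcons /= -[LHS]big_filter; apply: perm_big.
apply: uniq_perm => [||k].
- exact/filter_uniq/index_enum_uniq.
- rewrite rcons_uniq take_uniq ?enum_uniq // andbT in_take ?mem_enum //.
  by rewrite index_enum_ord ltnn.
- rewrite mem_filter mem_rcons inE in_take ?mem_enum //.
  rewrite index_enum_ord mem_index_enum andbT.
  by rewrite leq_eqVlt.
Qed.

Lemma eps_neq0 : eps != 0.
Proof. by case: heps => ->; rewrite ?oppr_eq0 oner_eq0. Qed.

Lemma wPE m : wP m = - (eps / kappa * (A m / tauP (xi m))).
Proof. by rewrite /wP (TQ_ratio heta hXi hP.1) // mulrN. Qed.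

Lemma wQE m : wQ m = - (eps * kappa * (A m / tauQ (xi m))).
Proof. by rewrite /wQ (TQ_ratio heta hXi hQ.1) // mulrN. Qed.

(** The term of B diagonal in [n] reverses the sign of the part of the scalar product at
    [xi n - eta]. Taking out an overall minus sign restores it and turns [Z (xi n)] into
    [Z (xi n) - 2 * Z (xi n)]; the second piece is the summand [a = n], so the sum now runs over all
    sites. *)
Lemma form_factor_Zsum :
  vdm xi * pairing L (sigma_z n *m V) =
  - (\prod_(k < N | (k <= n)%N) (tauP (xi k) / tauQ (xi k))) *
    (Z (xi n) + A n ^+ 2 / (tauP (xi n) * tauQ (xi n)) * Z (xi n - eta)
     - 2 * \sum_a A n * dxi xi n / tauP (xi n) * (tauP (xi a) / (A a * dxi xi a))
           * Z (xi a)).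
Proof.
have xiD := Xi_csinh hXi.
have tP0 m : tauP (xi m) != 0 by exact: (TQ_tau_neq0 heta hXi hP.1).
have tQ0 m : tauQ (xi m) != 0 by exact: (TQ_tau_neq0 heta hXi hQ.1).
have A0 m : A m != 0 by exact: a_fun_xi_neq0.
have d0 := dxi_neq0 xiD.
have e0 := eps_neq0.
have [_ [_ Lvec]] := hP; have [_ [_ Vvec]] := hQ.
have := sigma_z_transfer eta xi kappa n; rewrite /=.
set T := transfer eta xi (twist kappa); set G := \big[_/_]_(_ <- _) _.
have -> : kappa *: opC eta xi (xi n) - kappa^-1 *: opB eta xi (xi n) =
    T (xi n) - (2 * kappa^-1) *: opB eta xi (xi n).
  by rewrite /T transfer_twist -scalerA scaler_nat mulr2n opprD addrA addrK.
move=> inv.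
pose nu := \prod_(k <- take n (enum 'I_N)) (eps * tauP (xi k)).
pose mu := \prod_(k <- take n (enum 'I_N)) (eps * tauQ (xi k)).
have LG : L *m G = nu *: L by apply: eigen_prod_left.
have GV : G *m V = mu *: V by apply: eigen_prod_right.
(* Sandwiching the operator identity: the right eigenvector absorbs [G] and [T (xi n)] on one side,
   the left eigenvector absorbs [G] and [T (xi n)] on the other, leaving B alone. *)
have ffE : mu * (eps * tauQ (xi n)) * pairing L (sigma_z n *m V) =
    nu * (eps * tauP (xi n) * pairing L V
          - 2 * kappa^-1 * pairing (L *m opB eta xi (xi n)) V).
  have GTV : sigma_z n *m (G *m T (xi n)) *m V =
      (mu * (eps * tauQ (xi n))) *: (sigma_z n *m V).
    by rewrite -!mulmxA Vvec -!scalemxAr GV -scalemxAr scalerA [mu * _]mulrC.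
  have LGX : L *m (G *m (T (xi n) - (2 * kappa^-1) *: opB eta xi (xi n))) =
      nu *: (eps * tauP (xi n) *: L - (2 * kappa^-1) *: (L *m opB eta xi (xi n))).
    by rewrite mulmxA LG -scalemxAl mulmxBr -scalemxAr Lvec.
  have : (L *m (sigma_z n *m (G *m T (xi n)) *m V)) 0 0 =
      (L *m (G *m (T (xi n) - (2 * kappa^-1) *: opB eta xi (xi n))) *m V) 0 0.
    by rewrite -inv !mulmxA.
  have lin (x y : C) (M1 M2 : 'M[C]_1) :
      (x *: M1 - y *: M2) 0 0 = x * M1 0 0 - y * M2 0 0 by rewrite !mxE.
  rewrite GTV LGX -scalemxAr -scalemxAl mulmxBl -!scalemxAl.
  by rewrite [LHS]mxE [RHS]mxE lin.
have numu : nu * (eps * tauP (xi n)) / (mu * (eps * tauQ (xi n))) =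
    \prod_(k < N | (k <= n)%N) (tauP (xi k) / tauQ (xi k)).
  have -> : nu * (eps * tauP (xi n)) / (mu * (eps * tauQ (xi n))) =
      nu / mu * ((eps * tauP (xi n)) / (eps * tauQ (xi n))).
    by rewrite invfM mulrACA.
  rewrite prod_leq_take /nu /mu -prodf_div; congr (_ * _).
    apply: eq_bigr => k _; have := tQ0 k; move: (tauP _) (tauQ _) => x y y0.
    by field; rewrite y0 e0.
  by have := tQ0 n; move: (tauP _) (tauQ _) => x y y0; field; rewrite y0 e0.
have mu0 : mu != 0.
  by rewrite /mu prodf_seq_neq0; apply/allP => k _; apply/implyP => _; rewrite mulf_neq0.
have wP0 a : wP a != 0.
  by rewrite wPE oppr_eq0 !mulf_neq0 ?invr_eq0 ?A0 ?tP0.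
have BE : vdm xi * pairing (L *m opB eta xi (xi n)) V =
    - (A n * wQ n * Z (xi n - eta)) +
    \sum_(a | a != n) A n * (dxi xi n / dxi xi a) / wP a * Z (xi a).
  exact: (opB_element xiD bases).
have LVE : vdm xi * pairing L V = Z (xi n) + wP n * wQ n * Z (xi n - eta).
  exact: (Zsum_split xiD bases).
rewrite -numu.
have -> : pairing L (sigma_z n *m V) = nu * (eps * tauP (xi n) * pairing L V
    - 2 * kappa^-1 * pairing (L *m opB eta xi (xi n)) V) / (mu * (eps * tauQ (xi n))).
  by rewrite -ffE mulrC mulKf // !mulf_neq0.
have -> : vdm xi * (nu * (eps * tauP (xi n) * pairing L V
    - 2 * kappa^-1 * pairing (L *m opB eta xi (xi n)) V) / (mu * (eps * tauQ (xi n)))) =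
  nu / (mu * (eps * tauQ (xi n))) * (eps * tauP (xi n) * (vdm xi * pairing L V)
    - 2 * kappa^-1 * (vdm xi * pairing (L *m opB eta xi (xi n)) V)).
  by ring.
rewrite LVE BE [\sum_a _](bigD1 n) //=.
pose S := \sum_(i < N | i != n)
  A n * dxi xi n / tauP (xi n) * (tauP (xi i) / (A i * dxi xi i)) * Z (xi i).
rewrite -/S.
have -> : \sum_(a | a != n) A n * (dxi xi n / dxi xi a) / wP a * Z (xi a) =
    - (kappa * eps * tauP (xi n)) * S.
  rewrite /S mulr_sumr; apply: eq_bigr => a an; rewrite wPE.
  have := d0 a; have := A0 a; have := tP0 a; have := tP0 n.
  move: (dxi xi a) (A a) (tauP (xi a)) (tauP (xi n)) (A n) (dxi xi n) (Z _).
  move=> da Aa ta tn An dn z tn0 ta0 Aa0 da0.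
  by case: heps => ->; field; rewrite ?hkappa ?tn0 ?ta0 ?Aa0 ?da0 ?oppr_eq0 ?oner_eq0.
rewrite wPE wQE; clearbody nu mu S; have := d0 n; have := A0 n; have := tP0 n; have := tQ0 n.
move: (dxi xi n) (A n) (tauP _) (tauQ _) (Z _) (Z _).
move=> dn An tp tq z1 z2 tq0 tp0 An0 dn0.
by case: heps => ->; field; rewrite ?hkappa ?tq0 ?tp0 ?An0 ?dn0 ?mu0 ?oppr_eq0 ?oner_eq0.
Qed.

End FormFactor.

(** * Determinant representations *)

(** The cofactors of row [n] do not involve [v]. Values of [Zsum] at several points are thus one
    linear form on different rows, and their combination is again one determinant. *)
Lemma det_row_linear (R : comRingType) (d : nat) (n : 'I_d) (B : 'M[R]_d) :
  exists w : 'I_d -> R, forall v : 'I_d -> R,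
  \det (\matrix_(m, k) if m == n then v k else B m k) = \sum_k v k * w k.
Proof.
exists (fun k => cofactor B n k) => v; rewrite (expand_det_row _ n).
apply: eq_bigr => k _; rewrite mxE eqxx; congr (_ * (_ * \det _)).
by apply/matrixP => i j; rewrite !mxE eq_sym (negbTE (neq_lift _ _)).
Qed.

Section FormFactorDet.
Context {R : realType} {d : nat}.
Local Notation N := d.+1.
Local Notation C := (R[i]).
Variables (eta : C) (xi : 'I_N -> C).
Hypothesis heta : ~ commensurate eta ipi.
Hypothesis hXi : forall i j : 'I_N, i != j -> Xi eta xi i `&` Xi eta xi j = set0.
Variables (bra : config N -> 'rV[C]_#|config N|) (ket : config N -> 'cV[C]_#|config N|).
Hypothesis bases : SoV_bases eta xi bra ket.
Variables (kappa eps : C).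
Hypotheses (hkappa : kappa != 0) (heps : eps = 1 \/ eps = -1).
Variables (n : 'I_N) (p q : 'I_N -> C) (tauP tauQ : C -> C).
Hypothesis hPden : forall m, tpoly p (xi m - eta) != 0.
Hypothesis hQden : forall m, tpoly q (xi m - eta) != 0.
Hypothesis hP : left_eigenstate eta xi bra p tauP kappa eps.
Hypothesis hQ : right_eigenstate eta xi ket q tauQ kappa eps.
Hypothesis hxp : forall m k, csinh (xi m - p k) != 0.
Hypothesis hxpe : forall m k, csinh (xi m - p k - eta) != 0.

Let A m := a_fun eta xi (xi m).
Let P := tpoly p.

(* The scalar product is [det M / det Y] without the row [wrow], and that row
   accounts for the matrix element of B. *)
Definition Y_mx : 'M[C]_N := \matrix_(m, k) (tauQ (xi m) / csinh (xi m - p k)).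

Definition wrow k : C := dxi xi n * tauQ (xi n) / d_fun xi (p k) *
  (P (p k - eta) / P (xi n - eta)) * (P (p k + ipi) / P (xi n + ipi)).

Definition M_mx : 'M[C]_N := \matrix_(m, k)
  (tauQ (xi m) / csinh (xi m - p k) - tauP (xi m) / csinh (xi m - p k - eta)
   + (m == n)%:R * wrow k).

Let u k y : C := \prod_(l | l != k) csinh (y - p l).
Let S m : C := \prod_l csinh (xi m - p l).
Let C0 : C := \prod_(j < N) (cexp (ipi / 2) / 2).

Let tP0 m : tauP (xi m) != 0.
Proof. exact: (TQ_tau_neq0 heta hXi hP.1). Qed.

Let tQ0 m : tauQ (xi m) != 0.
Proof. exact: (TQ_tau_neq0 heta hXi hQ.1). Qed.

Let A0 m : A m != 0.
Proof. exact: a_fun_xi_neq0. Qed.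

Let S0 m : S m != 0.
Proof. by apply/prodf_neq0 => l _. Qed.

Let C00 : C0 != 0.
Proof. by apply/prodf_neq0 => j _; rewrite mulf_neq0 ?cexp_neq0 // invr_eq0 pnatr_eq0. Qed.

Lemma prod_but (y : C) k : csinh (y - p k) != 0 ->
  u k y = (\prod_l csinh (y - p l)) / csinh (y - p k).
Proof. by move=> yk; rewrite [X in X / _](bigD1 k) //= [RHS]mulrC mulKf. Qed.

Lemma ev_u m k : u k (xi m) = S m / tauQ (xi m) * (tauQ (xi m) / csinh (xi m - p k)).
Proof. by rewrite prod_but // mulrA divfK. Qed.

(** Multiplying [TQ_xi] by [TQ_xi_ipi] and applying [tpolyM_ipi] gives, with [p] ranging over the
    roots, [A^2 * prod sinh(xi - eta - p) = - tauP^2 * prod sinh(xi - p)], which eliminates [A]. *)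
Lemma ev_u_eta m k : A m ^+ 2 / (tauP (xi m) * tauQ (xi m)) * u k (xi m - eta) =
  S m / tauQ (xi m) * - (tauP (xi m) / csinh (xi m - p k - eta)).
Proof.
have swap l : xi m - eta - p l = xi m - p l - eta by rewrite addrAC.
rewrite prod_but ?swap //.
have E1 := TQ_xi hP.1 m; have E2 := TQ_xi_ipi hP.1 m.
have := tpolyM_ipi p (xi m); have := tpolyM_ipi p (xi m - eta).
rewrite -/P -/(S m) -/C0 -/(A m) in E1 E2 *.
move: (\prod_l csinh (xi m - eta - p l)) (S m) => S' Sm.
have := hxpe m k; have := tP0 m; have := tQ0 m; have := C00.
move: (csinh _) (tauP _) (tauQ _) (A m) C0 E1 E2 => s tp tq a c E1 E2.
move: (P _) (P _) (P _) (P _) E1 E2 => P1 P2 P3 P4 E1 E2 c0 tq0 tp0 s0 F1 F2.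
have key : a ^+ 2 * S' = - (tp ^+ 2 * Sm).
  apply: (mulfI c0).
  have -> : c * (a ^+ 2 * S') = - (- (a * P3)) * (a * P1).
    by transitivity (a ^+ 2 * (P3 * P1)); [rewrite F1|]; ring.
  rewrite -E1 -E2.
  by transitivity (- (tp ^+ 2 * (P4 * P2))); [|rewrite F2]; ring.
transitivity (a ^+ 2 * S' / (tp * tq * s)); first by field; rewrite s0 tq0 tp0.
by rewrite key; field; rewrite s0 tq0 tp0.
Qed.

(* Lagrange interpolation at the inhomogeneities of the trigonometric
   polynomial P(x - eta) P(x + i pi) - P(x - eta + i pi) P(x). *)
Lemma wrow_sum k : (S n / tauQ (xi n)) * wrow k =
  - 2 * \sum_a A n * dxi xi n / tauP (xi n) * (tauP (xi a) / (A a * dxi xi a))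
        * u k (xi a).
Proof.
have xiD := Xi_csinh hXi; have d0 := dxi_neq0 xiD.
pose W x := P (x - eta) * P (x + ipi).
have We : expoly 2^-1 N.*2 W.
  by rewrite -addnn; apply: expolyM; apply: expoly_shift; apply: tpoly_expoly.
have WE := expoly_odd_part We.
pose Wm x := W x - (-1) ^+ N * W (x + ipi).
(* At a root of [P] the quasi-periodicity under [2 i pi] kills the shifted term, so [W (p k)] is a
   value of the trigonometric polynomial [Wm]. *)
have Wp x : P x = 0 -> Wm x = W x.
  by move=> Px; rewrite /Wm /W [P (x + ipi + ipi)]tpoly_2ipi -/P Px !mulr0 subr0.
(* At the inhomogeneities the two TQ relations make both terms of [Wm] equal; this is the origin of
   the factor 2. *)
have Wxi m : Wm (xi m) = - (2 * (tauP (xi m) / A m) * C0 * S m).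
  have E1 := TQ_xi hP.1 m; have E2 := TQ_xi_ipi hP.1 m.
  have E3 := tpolyM_ipi p (xi m); rewrite -/P -/(S m) -/C0 -/(A m) in E1 E2 E3.
  rewrite /Wm /W [P (xi m + ipi + ipi)]tpoly_2ipi -/P [_ + ipi - eta]addrAC.
  rewrite -[_ * C0 * _]mulrA -E3.
  have := sqrr_sign C N; rewrite expr2; have := A0 m.
  move: (A m) (tauP _) ((-1) ^+ _) E1 E2 => a t s E1 E2 a0 s1.
  rewrite mulrA [_ * (s * _)]mulrCA.
  move: (P (xi m)) (P (xi m - eta)) (P (xi m + ipi)) (P (xi m - eta + ipi)) E1 E2.
  move=> P1 P2 P3 P4 E1 E2.
  have -> : P2 = - (t * P1) / a by rewrite E1 opprK mulrC mulKf.
  have -> : P4 = t * P3 / a by rewrite E2 mulrC mulKf.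
  by rewrite [s * (s * _)]mulrA s1 mul1r; field.
have Wxin : W (xi n) = - (tauP (xi n) / A n * C0 * S n).
  have := tpolyM_ipi p (xi n); rewrite -/P -/(S n) -/C0 /W -mulrA => <-.
  have := TQ_xi hP.1 n; rewrite -/P -/(A n); have := A0 n.
  move: (A n) (tauP _) (P (xi n)) (P (xi n - eta)) (P (xi n + ipi)) => b t P1 P2 P3 b0 E1.
  have -> : P2 = - (t * P1) / b by rewrite E1 opprK mulrC mulKf.
  by ring.
have pf : W (p k) / d_fun xi (p k) = 2 * C0 *
    \sum_a (tauP (xi a) / (A a * dxi xi a)) * u k (xi a).
  rewrite -Wp ?/P ?tpoly_root // (expoly_partial_fraction _ WE); last 2 first.
  - by move=> i j /xiD[].
  - by move=> i; rewrite csinh_subC oppr_eq0.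
  rewrite mulr_sumr; apply: eq_bigr => i _; rewrite -/(Wm _) Wxi prod_but // -/(S i).
  rewrite [csinh (p k - _)]csinh_subC -/(dxi xi i); have := hxp i k; have := d0 i.
  have := A0 i; move: (A i) (dxi xi i) (csinh _) (tauP _) (S i) => b dd s t s' b0 dd0 s0.
  by field; rewrite b0 dd0 s0.
have -> : wrow k = dxi xi n * tauQ (xi n) / W (xi n) * (W (p k) / d_fun xi (p k)).
  by rewrite /wrow /W invfM; ring.
rewrite pf Wxin.
have -> : \sum_a A n * dxi xi n / tauP (xi n) * (tauP (xi a) / (A a * dxi xi a))
        * u k (xi a) = A n * dxi xi n / tauP (xi n) *
    \sum_a (tauP (xi a) / (A a * dxi xi a)) * u k (xi a).
  by rewrite mulr_sumr; apply: eq_bigr => a _; rewrite !mulrA.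
have := d0 n; have := A0 n; have := tP0 n; have := tQ0 n; have := S0 n.
move: (\sum_a _) (dxi xi n) (A n) (tauP _) (tauQ _) (S n) C0 C00.
move=> x dn a tp tq s c c0 s0 tq0 tp0 a0 dn0.
by field; rewrite c0 s0 tq0 tp0 a0.
Qed.

Let wP m : C := eps / kappa * (tpoly p (xi m) / tpoly p (xi m - eta)).
Let wQ m : C := eps * kappa * (tpoly q (xi m) / tpoly q (xi m - eta)).
Let f m : C := A m ^+ 2 / (tauP (xi m) * tauQ (xi m)).

Lemma wPQ m : wP m * wQ m = f m.
Proof.
rewrite /wP /wQ (TQ_ratio heta hXi hP.1) // (TQ_ratio heta hXi hQ.1) // /f -/(A m).
have := tP0 m; have := tQ0 m; move: (A m) (tauP _) (tauQ _) => a t t' t0 t0'.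
by case: heps => ->; field; rewrite ?t0 ?t0' ?hkappa.
Qed.

Lemma Zsum_det (c : C) y :
  (forall t : 'I_N -> C, \det (\matrix_(m, k) u k (t m)) = c * vdm t) ->
  c * Zsum eta xi wP wQ n y =
  \det (\matrix_(m, k) if m == n then u k y
                        else u k (xi m) + f m * u k (xi m - eta)).
Proof.
move=> cE.
(* Row [n] must not be split between two points: its value is attached to the label 1 only, and
   configurations with [h n = 0] then have a zero row. *)
pose g (m : 'I_N) (i : 'I_2) k : C := if m == n then (i == ord_max)%:R * u k y
  else f m ^+ (1 - i) * u k (xi_h eta xi (1 - i) m).
have -> : \matrix_(m, k) (if m == n then u k y
    else u k (xi m) + f m * u k (xi m - eta)) = \matrix_(m, k) \sum_i g m i k.
  apply/matrixP => m k; rewrite !mxE !big_ord_recl big_ord0 /g /xi_h.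
  case: ifP => _; first by rewrite mul0r add0r mul1r addr0.
  by rewrite /= !mul1r mul0r subr0 expr1 addr0 addrC.
rewrite det_sum_config [RHS](bigID (fun h : config N => h n == ord_max)) /=.
rewrite [X in _ = _ + X]big1 ?addr0 => [|h /negbTE hn]; last first.
  rewrite (expand_det_row _ n) big1 // => k _.
  by rewrite mxE /g eqxx hn !mul0r.
rewrite /Zsum mulr_sumr; apply: eq_bigr => h /eqP hn.
have -> : \matrix_(m, k) g m (h m) k = diag_mx (\row_m f m ^+ (1 - h m)) *m
    \matrix_(m, k) u k (setx (cosites eta xi h) n y m).
  apply/matrixP => m k; rewrite mul_diag_mx !mxE /g /setx /cosites.
  by case: eqP => [->|//]; rewrite hn eqxx.
rewrite det_mulmx det_diag cE mulrCA; congr (_ * _).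
by apply: eq_bigr => m _; rewrite mxE wPQ.
Qed.

(** The diagonal [D] turns [Y_mx] into evaluations of the basis [u], so that
    [c * vdm xi = \det D * \det Y_mx] with the same unknown [c] as in [Zsum_det]; this relation
    removes [c] and the normalization [vdm xi] together. *)
Lemma form_factor_det :
  pairing (left_sep eta xi bra P kappa eps)
    (sigma_z n *m right_sep eta xi ket (tpoly q) kappa eps) * \det Y_mx =
  - (\prod_(k < N | (k <= n)%N) (tauP (xi k) / tauQ (xi k))) * \det M_mx.
Proof.
have [c cE] := det_expoly (fun k => expoly_prod_csinh_but k p).
set ff := pairing _ _; set pr := \prod_(k < N | _) _.
pose D : 'M[C]_N := diag_mx (\row_m (S m / tauQ (xi m))).
have D0 : \det D != 0.
  rewrite det_diag; apply/prodf_neq0 => m _.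
  by rewrite mxE mulf_neq0 ?invr_eq0 ?S0 ?tQ0.
have detY : c * vdm xi = \det D * \det Y_mx.
  rewrite -cE -det_mulmx; congr (\det _); apply/matrixP => m k.
  by rewrite mul_diag_mx !mxE -ev_u.
have ffE := form_factor_Zsum heta hXi bases hkappa heps n hPden hQden hP hQ.
rewrite -/ff -/pr in ffE.
have [w wE] := det_row_linear n (\matrix_(m, k) (u k (xi m) + f m * u k (xi m - eta))).
have ZE y : c * Zsum eta xi wP wQ n y = \sum_k u k y * w k.
  rewrite (Zsum_det _ cE) -wE; congr (\det _); apply/matrixP => m k.
  by rewrite !mxE.
apply: (mulfI D0).
pose Z := Zsum eta xi wP wQ n.
pose co a : C := A n * dxi xi n / tauP (xi n) * (tauP (xi a) / (A a * dxi xi a)).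
pose br := Z (xi n) + f n * Z (xi n - eta) - 2 * \sum_a co a * Z (xi a).
have {}ffE : vdm xi * ff = - pr * br by exact: ffE.
pose v k := u k (xi n) + f n * u k (xi n - eta) - 2 * \sum_a co a * u k (xi a).
have detM : \det D * \det M_mx = c * br.
  rewrite -det_mulmx; transitivity (\sum_k v k * w k).
    rewrite -wE; congr (\det _); apply/matrixP => m k.
    rewrite mul_diag_mx !mxE mulrDr mulrBr -ev_u -mulrN -ev_u_eta -/(f m).
    case: (eqVneq m n) => [->|_]; last by rewrite mul0r mulr0 addr0.
    by rewrite mul1r wrow_sum mulNr.
  transitivity (\sum_k u k (xi n) * w k + f n * (\sum_k u k (xi n - eta) * w k)
      - 2 * \sum_a co a * \sum_k u k (xi a) * w k); last first.
    rewrite -!ZE /br mulrBr mulrDr [c * (f n * _)]mulrCA [c * (2 * _)]mulrCA.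
    congr (_ - 2 * _); rewrite mulr_sumr; apply: eq_bigr => a _.
    by rewrite -ZE mulrCA.
  under [X in _ = _ - 2 * X]eq_bigr do rewrite mulr_sumr.
  rewrite exchange_big /= !mulr_sumr -sumrN -!big_split /=; apply: eq_bigr => k _.
  rewrite /v mulrBl mulrDl -!mulrA mulr_suml.
  by congr (_ - 2 * _); apply: eq_bigr => a _; rewrite mulrA.
transitivity (c * (vdm xi * ff)); first by rewrite mulrA detY; ring.
by rewrite ffE [RHS]mulrCA detM; ring.
Qed.
End FormFactorDet.

(** * Eigenvalues as trigonometric polynomials of degree [N - 1] *)

Section EigenvalueInterpolation.
Context {R : realType} {d : nat}.
Local Notation N := d.+1.
Local Notation C := (R[i]).
Variables (eta : C) (xi : 'I_N -> C).
Variables (bra : config N -> 'rV[C]_#|config N|) (ket : config N -> 'cV[C]_#|config N|).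
Hypothesis bases : SoV_bases eta xi bra ket.
Variables (kappa eps : C).
Hypothesis heps : eps = 1 \/ eps = -1.

Lemma sov_coef_expoly (h : config N) a : expoly 1 d (fun lam => sov_coef eta xi lam h a).
Proof.
apply: eq_expoly (expolyZ (\prod_(b | b != a)
   csinh (xi_h eta xi (h a) a - xi_h eta xi (h b) b))^-1
  (expoly_prod_csinh_but a (fun b => xi_h eta xi (h b) b))) => x.
by rewrite [RHS]prodf_div [LHS]mulrC.
Qed.

Lemma sov_sum_expoly (F : config N -> 'I_N -> C) :
  expoly 1 d (fun lam => \sum_(h : config N) \sum_a F h a * sov_coef eta xi lam h a).
Proof. by do 2!apply: expoly_sum => ? _; apply/expolyZ/sov_coef_expoly. Qed.

(** The degree bound is read off the SoV actions of B and C: at a nonzero coordinate of the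
    eigenvector, [tau] is a fixed linear combination of the coefficients [sov_coef]. *)
Lemma left_eigen_expoly (w : config N -> C) (tau : C -> C) :
  left_eigen (transfer eta xi (twist kappa)) (\sum_(h : config N) w h *: bra h)
    (fun lam => eps * tau lam) -> expoly 1 d tau.
Proof.
move=> [v0 vT]; set v := \sum_(h : config N) _ in v0 vT.
have [j vj] : exists j, v 0 j != 0 by apply/rV0Pn.
pose G (h : config N) a : C :=
  w h * (kappa * (((h a == 0%N :> nat)%:R * d_fun xi (xi_h eta xi 1 a)) * bra (raise a h) 0 j)
         - kappa^-1 * (((h a == 1%N :> nat)%:R * a_fun eta xi (xi_h eta xi 0 a))
                       * bra (lower a h) 0 j)).
apply: eq_expoly (expolyZ (eps * v 0 j)^-1 (sov_sum_expoly G)) => lam.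
have e0 : eps != 0 by case: heps => ->; rewrite ?oppr_eq0 oner_eq0.
have -> : \sum_(h : config N) \sum_a G h a * sov_coef eta xi lam h a =
    (v *m transfer eta xi (twist kappa) lam) 0 j.
  rewrite transfer_twist mulmx_suml summxE; apply: eq_bigr => h _.
  rewrite -scalemxAl mulmxDr -!scalemxAr (bra_C bases) (bra_B bases).
  rewrite scalerN !mxE !summxE !mulr_sumr -sumrB mulr_sumr; apply: eq_bigr => a _.
  by rewrite !mxE /G; ring.
by rewrite vT mxE; move: (v 0 j) vj => z z0; field; rewrite e0 z0.
Qed.

Lemma right_eigen_expoly (w : config N -> C) (tau : C -> C) :
  right_eigen (transfer eta xi (twist kappa)) (\sum_(h : config N) w h *: ket h)
    (fun lam => eps * tau lam) -> expoly 1 d tau.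
Proof.
move=> [v0 vT]; set v := \sum_(h : config N) _ in v0 vT.
have [j vj] : exists j, v j 0 != 0.
  have : v^T != 0 by rewrite trmx_eq0.
  by case/rV0Pn => j; rewrite mxE; exists j.
pose G (h : config N) a : C :=
  w h * (kappa * (((h a == 1%N :> nat)%:R * d_fun xi (xi_h eta xi 1 a)) * ket (lower a h) j 0)
         - kappa^-1 * (((h a == 0%N :> nat)%:R * a_fun eta xi (xi_h eta xi 0 a))
                       * ket (raise a h) j 0)).
apply: eq_expoly (expolyZ (eps * v j 0)^-1 (sov_sum_expoly G)) => lam.
have e0 : eps != 0 by case: heps => ->; rewrite ?oppr_eq0 oner_eq0.
have -> : \sum_(h : config N) \sum_a G h a * sov_coef eta xi lam h a =
    (transfer eta xi (twist kappa) lam *m v) j 0.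
  rewrite transfer_twist mulmx_sumr summxE; apply: eq_bigr => h _.
  rewrite -scalemxAr mulmxDl -!scalemxAl (ket_C bases) (ket_B bases).
  rewrite scalerN !mxE !summxE !mulr_sumr -sumrB mulr_sumr; apply: eq_bigr => a _.
  by rewrite !mxE /G; ring.
by rewrite vT mxE; move: (v j 0) vj => z z0; field; rewrite e0 z0.
Qed.

End EigenvalueInterpolation.

(** * The representation with arbitrary parameters [z] *)

Section CauchyForm.
Context {R : realType} {d : nat}.
Local Notation N := d.+1.
Local Notation C := (R[i]).
Variables (eta : C) (xi : 'I_N -> C) (n : 'I_N) (p : 'I_N -> C) (tauP tauQ : C -> C).
Hypothesis xiD : forall i j, i != j -> csinh (xi i - xi j) != 0.

(** The factor [e^lam] in [hat] makes the function [i pi]-periodic and separates the variables: [e^x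
    sinh(y - xi) - e^y sinh(x - xi) = - e^xi sinh(x - y)] cancels the denominator and leaves a
    product of a factor in [x] and a factor in [y] at each node. *)
Lemma hat_sub tau x y : expoly 1 d tau -> d_fun xi x != 0 -> d_fun xi y != 0 ->
  csinh (x - y) != 0 ->
  (hat xi tau x - hat xi tau y) / csinh (x - y) =
  \sum_m (csinh (x - xi m))^-1 *
     (cexp (xi m) / dxi xi m * (tau (xi m) / csinh (xi m - y))).
Proof.
move=> taud dx dy xy.
have d0 m : dxi xi m != 0.
  by apply/prodf_neq0 => b bm; apply: xiD; rewrite eq_sym.
have dP z : d_fun xi z != 0 -> forall m, csinh (z - xi m) != 0.
  by move=> /prodf_neq0 dz m; apply: dz.
have hatE z : d_fun xi z != 0 -> hat xi tau z =
    \sum_m cexp z * (tau (xi m) / (dxi xi m * csinh (z - xi m))).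
  move=> dz; rewrite /hat -mulrA.
  by rewrite (expoly_partial_fraction xiD taud (dP z dz)) mulr_sumr.
rewrite !hatE // -sumrB mulr_suml; apply: eq_bigr => m _.
have := dP x dx m; have := dP y dy m; have := d0 m; have := xy.
rewrite [csinh (xi m - y)]csinh_subC.
have : cexp x * csinh (y - xi m) - cexp y * csinh (x - xi m) =
    - (cexp (xi m) * csinh (x - y)).
  rewrite !csinhE !cexpE.
  have := cexp_neq0 x; have := cexp_neq0 y; have := cexp_neq0 (xi m).
  move: (cexp x) (cexp y) (cexp (xi m)) => a b c c0 b0 a0.
  by field; rewrite a0 b0 c0.
move: (csinh (x - y)) (csinh (x - xi m)) (csinh (y - xi m)) (dxi xi m).
move: (cexp x) (cexp y) (cexp (xi m)) (tau _) => a b c t D X Y e E D0 e0 Y0 X0.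
transitivity (t / e * (a * Y - b * X) / (X * Y * D)).
  by field; rewrite X0 Y0 D0 e0.
by rewrite E; field; rewrite X0 Y0 D0 e0.
Qed.

Hypotheses (tauPd : expoly 1 d tauP) (tauQd : expoly 1 d tauQ).
Variable z : 'I_N -> C.
Hypothesis hz : regular_z eta xi p z tauQ n.

Let dz i m : csinh (z i - xi m) != 0.
Proof. by have /prodf_neq0 h := z_d_z hz i; apply: h. Qed.

Lemma regular_z_xp m k : csinh (xi m - p k) != 0.
Proof. by have /prodf_neq0 h := z_d_p hz k; rewrite csinh_subC oppr_eq0; apply: h. Qed.

Lemma regular_z_xpe m k : csinh (xi m - p k - eta) != 0.
Proof.
have /prodf_neq0 h := z_d_p_eta hz k.
have -> : xi m - p k - eta = - (p k + eta - xi m) by ring.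
by rewrite csinhN oppr_eq0; apply: h.
Qed.

Lemma S_tau_factor :
  S_tau_mx eta xi p z tauP tauQ + Pz_tau_mx eta xi p z tauQ n =
  (\matrix_(i, m) (csinh (z i - xi m))^-1) *m
    (diag_mx (\row_m (cexp (xi m) / dxi xi m)) *m M_mx eta xi n p tauP tauQ).
Proof.
apply/matrixP => i k; rewrite !mxE.
have -> : z i - p k - eta = z i - (p k + eta) by rewrite opprD addrA.
have zpe : csinh (z i - (p k + eta)) != 0 by rewrite opprD addrA (z_sinh_p_eta hz).
rewrite (hat_sub tauQd (z_d_z hz i) (z_d_p hz k) (z_sinh_p hz i k)).
rewrite (hat_sub tauPd (z_d_z hz i) (z_d_p_eta hz k) zpe) -sumrB.
have -> : cexp (xi n) * tauQ (xi n) / (d_fun xi (p k) * csinh (z i - xi n)) *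
    (tpoly p (p k - eta) / tpoly p (xi n - eta)) *
    (tpoly p (p k + ipi) / tpoly p (xi n + ipi)) =
    \sum_m (csinh (z i - xi m))^-1 * (cexp (xi m) / dxi xi m) *
      ((m == n)%:R * wrow eta xi n p tauQ k).
  rewrite (bigD1 n) //= big1 ?addr0 => [|m /negbTE ->]; last by rewrite mul0r mulr0.
  have d0 : dxi xi n != 0 by apply/prodf_neq0 => b bm; apply: xiD; rewrite eq_sym.
  rewrite eqxx mul1r /wrow; move: (tpoly _ _ / _) (tpoly _ _ / _) => x y.
  move: (z_d_p hz k) (dz i n) d0; move: (dxi xi n) (d_fun _ _) (csinh _) => e b s b0 s0 e0.
  by field; rewrite s0 b0 e0.
rewrite -big_split /=; apply: eq_bigr => m _; rewrite mul_diag_mx !mxE.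
have -> : xi m - (p k + eta) = xi m - p k - eta by rewrite opprD addrA.
by ring.
Qed.

Lemma p_distinct i j : i != j -> csinh (p i - p j) != 0.
Proof.
rewrite -val_eqE /= neq_ltn => /orP[ij|ji]; first exact: z_p_distinct hz _ _ ij.
by rewrite csinh_subC oppr_eq0; apply: z_p_distinct hz _ _ ji.
Qed.

Let xi_vdm : vdm xi != 0.
Proof. exact: vdm_neq0. Qed.

(** The diagonal of residues contributes [e^(sum xi)] and the inverse of the product of all [dxi].
    The latter is a product of two Vandermonde products in [xi], cancelled by those of the Cauchy
    determinants in [(z, xi)] and [(xi, p)]. *)
Lemma det_S_tau :
  \det (S_tau_mx eta xi p z tauP tauQ + Pz_tau_mx eta xi p z tauQ n) *
    \prod_i \prod_j (csinh (z i - xi j) * csinh (xi j - p i)) *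
    \det (Y_mx xi p tauQ) =
  cexp (\sum_l xi l) * (\prod_j tauQ (xi j)) *
    \prod_(i < N) \prod_(j < N | (i < j)%N) (csinh (z j - z i) * csinh (p i - p j)) *
    \det (M_mx eta xi n p tauP tauQ).
Proof.
rewrite S_tau_factor !det_mulmx det_diag.
have -> : Y_mx xi p tauQ = diag_mx (\row_m tauQ (xi m)) *m
    \matrix_(m, k) (csinh (xi m - p k))^-1.
  by apply/matrixP => m k; rewrite mul_diag_mx !mxE.
rewrite det_mulmx det_diag.
under eq_bigr do rewrite mxE; under [X in _ * (X * _) = _]eq_bigr do rewrite mxE.
have Ez := det_cauchy_csinh xiD dz.
have Ep := det_cauchy_csinh p_distinct regular_z_xp.
have dxiE : \prod_i dxi xi i =
    (\prod_(i < N) \prod_(j < N | (i < j)%N) csinh (xi i - xi j)) * vdm xi.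
  rewrite prod_neq_pair /vdm -big_split /=; apply: eq_bigr => i _.
  by rewrite -big_split.
have -> : \prod_(i < N) \prod_(j < N | (i < j)%N) (csinh (z j - z i) * csinh (p i - p j)) =
    vdm z * \prod_(i < N) \prod_(j < N | (i < j)%N) csinh (p i - p j).
  by rewrite /vdm -big_split /=; apply: eq_bigr => i _; rewrite -big_split.
have -> : \prod_i \prod_j (csinh (z i - xi j) * csinh (xi j - p i)) =
    (\prod_i \prod_j csinh (z i - xi j)) * \prod_i \prod_j csinh (xi i - p j).
  rewrite [X in _ = _ * X]exchange_big /= -big_split /=; apply: eq_bigr => i _.
  by rewrite -big_split.
rewrite prodf_div /= -cexp_sum dxiE.
have X0 : \prod_(i < N) \prod_(j < N | (i < j)%N) csinh (xi i - xi j) != 0.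
  by do 2!apply/prodf_neq0 => ? ?; apply: xiD; rewrite -val_eqE /= ltn_eqF.
move: Ez Ep; move: (\det _) (\det _) (\det _) => D1 D2 D3.
move: (\prod_i \prod_j csinh (z i - xi j)) (\prod_i \prod_j csinh (xi i - p j)) => A1 A2.
move: (\prod_(i < N) \prod_(j < N | (i < j)%N) csinh (xi i - xi j)) X0 => X X0.
move: (\prod_(i < N) \prod_(j < N | (i < j)%N) csinh (p i - p j)) (vdm xi) xi_vdm => Y v v0.
move: (vdm z) (cexp _) (\prod_(i < N) tauQ (xi i)) => w e t E1 E2.
transitivity ((D3 * A1) * (D2 * A2) * (e * t * D1) / (X * v)).
  by field; rewrite X0 v0.
by rewrite E1 E2; field; rewrite X0 v0.
Qed.

Lemma det_Y_mx_neq0 : \det (Y_mx xi p tauQ) != 0.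
Proof.
have -> : Y_mx xi p tauQ = diag_mx (\row_m tauQ (xi m)) *m
    \matrix_(m, k) (csinh (xi m - p k))^-1.
  by apply/matrixP => m k; rewrite mul_diag_mx !mxE.
rewrite det_mulmx det_diag mulf_neq0 //.
  by apply/prodf_neq0 => m _; rewrite mxE (z_tauQ hz).
have Ep := det_cauchy_csinh p_distinct regular_z_xp.
have : vdm xi * \prod_(i < N) \prod_(j < N | (i < j)%N) csinh (p i - p j) != 0.
  rewrite mulf_neq0 //; apply/prodf_neq0 => i _; apply/prodf_neq0 => j ij.
  exact: z_p_distinct hz _ _ ij.
by rewrite -Ep mulf_eq0 negb_or => /andP[].
Qed.

End CauchyForm.

Section Regularity.
Context {R : realType} {N : nat}.
Local Notation C := (R[i]).
Variables (eta : C) (xi : 'I_N -> C).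
Hypothesis heta : ~ commensurate eta ipi.
Hypothesis hXi : forall i j : 'I_N, i != j -> Xi eta xi i `&` Xi eta xi j = set0.
Variables (p : 'I_N -> C) (tau : C -> C).
Hypothesis TQ : TQ_solution eta xi (tpoly p) tau.
Hypothesis hden : forall m, tpoly p (xi m - eta) != 0.
Hypothesis hap : forall k, a_fun eta xi (p k) != 0.

Lemma regular_root_eta m k : csinh (xi m - p k - eta) != 0.
Proof.
have /prodf_neq0 h := hap k; have -> : xi m - p k - eta = - (p k - xi m + eta) by ring.
by rewrite csinhN oppr_eq0; apply: h.
Qed.

Lemma tpoly_eta_ipi_neq0 m : tpoly p (xi m - eta + ipi) != 0.
Proof.
have : tpoly p (xi m - eta) * tpoly p (xi m - eta + ipi) != 0.
  rewrite tpolyM_ipi mulf_neq0 //; apply/prodf_neq0 => j _.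
    by rewrite mulf_neq0 ?cexp_neq0 // invr_eq0 pnatr_eq0.
  by rewrite addrAC regular_root_eta.
by rewrite mulf_eq0 negb_or => /andP[].
Qed.

Lemma tpoly_ipi_neq0 m : tpoly p (xi m + ipi) != 0.
Proof.
have : tau (xi m) * tpoly p (xi m + ipi) != 0.
  rewrite (TQ_xi_ipi TQ); apply: mulf_neq0; first exact: a_fun_xi_neq0.
  exact: tpoly_eta_ipi_neq0.
by rewrite mulf_eq0 negb_or => /andP[].
Qed.

(** Last link of a chain: [a_fun] nonzero at the roots gives [P (xi m - eta + i pi)] nonzero, TQ
    carries this to [P (xi m + i pi)], and [tpolyM_ipi] converts it into a statement about the
    roots. *)
Lemma regular_root m k : csinh (xi m - p k) != 0.
Proof.
have : tpoly p (xi m) * tpoly p (xi m + ipi) != 0.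
  apply: mulf_neq0; last exact: tpoly_ipi_neq0.
  exact: (TQ_tpoly_neq0 heta hXi TQ).
rewrite tpolyM_ipi mulf_eq0 negb_or => /andP[_ /prodf_neq0 h].
exact: h.
Qed.

End Regularity.

(** * The representation in terms of the roots of [Q] *)

Section CothForm.
Context {R : realType} {d : nat}.
Local Notation N := d.+1.
Local Notation C := (R[i]).
Variables (eta : C) (xi : 'I_N -> C).
Hypothesis heta : ~ commensurate eta ipi.
Hypothesis hXi : forall i j : 'I_N, i != j -> Xi eta xi i `&` Xi eta xi j = set0.
Variables (n : 'I_N) (p q : 'I_N -> C) (tauP tauQ : C -> C).
Hypothesis hPden : forall m, tpoly p (xi m - eta) != 0.
Hypothesis hQden : forall m, tpoly q (xi m - eta) != 0.
Hypothesis TQP : TQ_solution eta xi (tpoly p) tauP.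
Hypothesis TQQ : TQ_solution eta xi (tpoly q) tauQ.
Hypothesis hpq : regular_pq eta xi p q tauQ n.

Let P := tpoly p.
Let Q := tpoly q.
Let A m := a_fun eta xi (xi m).

(* [Qc j x] is [Q x * coth ((x - q j) / 2)] with the pole cancelled. *)
Let Qc j x : C :=
  ccosh ((x - q j) / 2) * \prod_(l | l != j) csinh ((x - q l) / 2).

(** The combination [W(x) - (-1)^N W(x + i pi)] for [W(x) = Qc j (x - eta) P(x + i pi)]. At [p_k]
    only the first term survives, and it carries the entry of [coth_mx]. *)
Let F j x := Qc j (x - eta) * P (x + ipi) - Qc j (x - eta + ipi) * P x.

(** A numerator free of eigenvalues for the [tauP] part. By the TQ equations, multiplying [F] at
    [xi m] by [tauP / tauQ] moves the shift by [eta] from [Q] to [P]; multiplying by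
    [sinh(x - q_j - eta)], twice sinh times cosh of the half argument, turns coth and its inverse
    into the squares. *)
Let K j x : C := 2 * (Q x * P (x - eta + ipi) * ccosh ((x - q j - eta) / 2) ^+ 2
  - Q (x + ipi) * P (x - eta) * csinh ((x - q j - eta) / 2) ^+ 2).

Lemma Qc_coth j x : csinh ((x - q j) / 2) != 0 ->
  Qc j x = Q x * ccoth ((x - q j) / 2).
Proof.
move=> x0; rewrite /Q /tpoly (bigD1 j) //= /Qc /ccoth; move: (\prod_(l | _) _) x0.
by move: (csinh _) (ccosh _) => s c g s0; field.
Qed.

Lemma Qc_expoly j : expoly 2^-1 N (Qc j).
Proof.
have : expoly 2^-1 (1 + \sum_(l < N | l != j) 1) (Qc j).
  apply: expolyM; first exact: expoly_ccosh_half.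
  by apply: expoly_prod => l _; apply: expoly_csinh_half.
by rewrite sum1_card cardC1 card_ord.
Qed.

Lemma F_expoly j : expoly 1 d (F j).
Proof.
pose G x := Qc j (x - eta) * P (x + ipi).
have Ge : expoly 2^-1 N.*2 G.
  rewrite -addnn; apply: expolyM; apply: expoly_shift; first exact: Qc_expoly.
  exact: tpoly_expoly.
apply: eq_expoly (expoly_odd_part Ge) => x; rewrite /G [P (x + ipi + ipi)]tpoly_2ipi -/P.
rewrite /F [x + ipi - eta]addrAC; congr (_ - _).
by rewrite mulrCA signrMK.
Qed.

Lemma K_expoly j : expoly 1 d.+1 (K j).
Proof.
pose G x := 2 * (Q x * P (x - eta + ipi) *
  (ccosh ((x - (q j + eta)) / 2) * ccosh ((x - (q j + eta)) / 2))).
have Ge : expoly 2^-1 (d.+2).*2 G.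
  have -> : (d.+2).*2 = (N + N + (1 + 1))%N by lia.
  apply: expolyZ; apply: expolyM; last by apply: expolyM; apply: expoly_ccosh_half.
  apply: expolyM; first exact: tpoly_expoly.
  exact: (expoly_shift (- eta) (expoly_shift ipi (tpoly_expoly p))).
apply: eq_expoly (expoly_odd_part Ge) => x; rewrite /G /K.
have -> : x + ipi - (q j + eta) = x - (q j + eta) + ipi by ring.
rewrite ccosh_half_ipi [x + ipi - eta]addrAC [P (x - eta + ipi + ipi)]tpoly_2ipi -/P.
have -> : x - q j - eta = x - (q j + eta) by ring.
have := cexp_half_sqr (ipi : C); rewrite cexp_ipi.
have := sqrr_sign C N; rewrite expr2 [(-1) ^+ d.+2]exprS.
move: ((-1) ^+ _) (cexp _) (csinh _) (ccosh _) => s e a b s2 e2.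
have -> : e * a * (e * a) = - (a * a) by rewrite mulrACA e2 mulN1r.
transitivity (2 * (Q x * P (x - eta + ipi) * (b * b)) -
  s * s * (2 * (Q (x + ipi) * P (x - eta) * (a * a)))); first by ring.
by rewrite s2; ring.
Qed.

Let qe m j : csinh (xi m - q j - eta) != 0.
Proof. by apply: regular_root_eta => k; apply: pq_a_q hpq k. Qed.

Let pe m k : csinh (xi m - p k - eta) != 0.
Proof. by apply: regular_root_eta => j; apply: pq_a_p hpq j. Qed.

Let p0 m k : csinh (xi m - p k) != 0.
Proof. by apply: (regular_root heta hXi TQP) => // j; apply: pq_a_p hpq j. Qed.

Let dp k : d_fun xi (p k) != 0.
Proof. by apply/prodf_neq0 => m _; rewrite csinh_subC oppr_eq0. Qed.

Let xiD i j : i != j -> csinh (xi i - xi j) != 0.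
Proof. by move=> /(Xi_csinh hXi)[]. Qed.

Let d0 m : dxi xi m != 0.
Proof. exact: dxi_neq0 (Xi_csinh hXi) m. Qed.

Let half_qe m j : csinh ((xi m - eta - q j) / 2) != 0 /\ ccosh ((xi m - eta - q j) / 2) != 0.
Proof.
have := qe m j; rewrite addrAC csinh_double => E; split; apply: contraNneq E => ->.
  by rewrite mulr0 mul0r.
by rewrite mulr0.
Qed.

Let Qc_xi j m : Qc j (xi m - eta) = Q (xi m - eta) *
  (ccosh ((xi m - eta - q j) / 2) / csinh ((xi m - eta - q j) / 2)).
Proof. by rewrite Qc_coth //; case: (half_qe m j). Qed.

Let Qc_xi_ipi j m : Qc j (xi m - eta + ipi) = Q (xi m - eta + ipi) *
  (csinh ((xi m - eta - q j) / 2) / ccosh ((xi m - eta - q j) / 2)).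
Proof.
have [s0 c0] := half_qe m j.
have swap : xi m - eta + ipi - q j = xi m - eta - q j + ipi by rewrite addrAC.
rewrite Qc_coth swap; last by rewrite csinh_half_ipi mulf_neq0 ?cexp_neq0.
rewrite /ccoth csinh_half_ipi ccosh_half_ipi; congr (_ * _).
have := cexp_neq0 (ipi / 2 : C); move: (cexp _) (csinh _) (ccosh _) s0 c0.
by move=> e sh ch sh0 ch0 e0; field; rewrite e0 ch0.
Qed.

Lemma F_K j m : F j (xi m) * (tauP (xi m) / tauQ (xi m)) * csinh (xi m - (q j + eta)) =
  - K j (xi m).
Proof.
have [s0 c0] := half_qe m j.
rewrite /F Qc_xi Qc_xi_ipi /K opprD addrA [xi m - q j - eta]addrAC.
rewrite [csinh (xi m - eta - q j)]csinh_double.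
have A0 : A m != 0 by exact: a_fun_xi_neq0.
have tQ0 := TQ_tau_neq0 heta hXi TQQ hQden m.
have := TQ_xi TQP m; have := TQ_xi_ipi TQP m; have := TQ_xi TQQ m; have := TQ_xi_ipi TQQ m.
rewrite -/P -/Q -/(A m).
move: (csinh _) (ccosh _) (tauP _) (tauQ _) (A m) s0 c0 A0 tQ0.
move: (P (xi m)) (P (xi m - eta)) (P (xi m + ipi)) (P (xi m - eta + ipi)).
move: (Q (xi m)) (Q (xi m - eta)) (Q (xi m + ipi)) (Q (xi m - eta + ipi)).
move=> Q1 Q2 Q3 Q4 P1 P2 P3 P4 sh ch tp tq a sh0 ch0 a0 tq0 E1 E2 E3 E4.
have -> : Q2 = - (tq * Q1) / a by rewrite E2 opprK mulrC mulKf.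
have -> : Q4 = tq * Q3 / a by rewrite E1 mulrC mulKf.
have -> : P2 = - (tp * P1) / a by rewrite E4 opprK mulrC mulKf.
have -> : P4 = tp * P3 / a by rewrite E3 mulrC mulKf.
by field; rewrite sh0 ch0 a0 tq0.
Qed.

(** [X] holds the residues of [F] at the [xi m], divided by [tauQ]; the diagonal [gam] strips from
    column [k] the factor that the partial fractions of [F] at [p_k] leave in front of coth. *)
Let X : 'M[C]_N := \matrix_(j, m) - (F j (xi m) / (dxi xi m * tauQ (xi m))).
Let gam : 'M[C]_N := diag_mx (\row_k (d_fun xi (p k) / (Q (p k - eta) * P (p k + ipi)))).

Let Qc_p j k : Qc j (p k - eta) = Q (p k - eta) * ccoth ((p k - q j - eta) / 2).
Proof. by rewrite Qc_coth addrAC // (pq_coth_eta hpq). Qed.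

Let XY j k : \sum_m X j m * (tauQ (xi m) / csinh (xi m - p k)) =
  Q (p k - eta) * ccoth ((p k - q j - eta) / 2) * P (p k + ipi) / d_fun xi (p k).
Proof.
have -> : Q (p k - eta) * ccoth ((p k - q j - eta) / 2) * P (p k + ipi) = F j (p k).
  by rewrite /F Qc_p [P (p k)]tpoly_root mulr0 subr0.
rewrite (expoly_partial_fraction xiD (F_expoly j)) => [|m]; last first.
  by rewrite csinh_subC oppr_eq0.
apply: eq_bigr => m _; rewrite mxE [csinh (p k - _)]csinh_subC -/(dxi xi m).
have := d0 m; have := p0 m k; have := TQ_tau_neq0 heta hXi TQQ hQden m.
move: (dxi xi m) (csinh _) (tauQ _) (F _ _) => e s t f t0 s0 e0.
by field; rewrite t0 s0 e0.
Qed.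

Lemma coth_mx_factor : coth_mx eta p q = X *m Y_mx xi p tauQ *m gam.
Proof.
apply/matrixP => j k; rewrite mul_mx_diag !mxE.
under eq_bigr do rewrite [Y_mx _ _ _ _ _]mxE.
rewrite XY; have := dp k; have := pq_Q hpq k; have := pq_P_ipi hpq k.
rewrite -/P -/Q; move: (Q _) (P _) (d_fun _ _) (ccoth _) => a b e f b0 a0 e0.
by field; rewrite a0 b0 e0.
Qed.

(** The [tauQ] terms give the first coth, as in [coth_mx]. Through [F_K] the [tauP] terms become a
    partial fraction expansion of [K] at [p_k + eta] with the additional pole [q_j + eta], which
    yields the [frak_a] and [1 / sinh] terms. The row [wrow] meets only [m = n] and gives
    [Pz_mx]. *)
Lemma S_mx_factor : S_mx eta xi p q - Pz_mx eta xi p q n =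
  X *m M_mx eta xi n p tauP tauQ *m gam.
Proof.
apply/matrixP => j k; rewrite mul_mx_diag !mxE.
under [X in _ = X * _]eq_bigr do rewrite [M_mx _ _ _ _ _ _ _ _]mxE mulrDr mulrBr.
rewrite big_split sumrB /= XY.
have -> : \sum_m X j m * (tauP (xi m) / csinh (xi m - p k - eta)) =
    - (frak_a eta xi Q (p k) * ccoth ((p k - q j) / 2)
       - 2 * (d_fun xi (p k) / a_fun eta xi (q j)) *
          (Q (q j + eta) * P (q j + ipi) / (Q (p k - eta) * P (p k + ipi)))
          / csinh (p k - q j)) * (Q (p k - eta) * P (p k + ipi) / d_fun xi (p k)).
  have yx : p k + eta - (q j + eta) = p k - q j by ring.
  have yt m : csinh (p k + eta - xi m) != 0.
    by rewrite -[p k + eta - _]opprB csinhN oppr_eq0 opprD addrA.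
  have xt m : csinh (q j + eta - xi m) != 0.
    by rewrite -[q j + eta - _]opprB csinhN oppr_eq0 opprD addrA.
  have yx0 : csinh (p k + eta - (q j + eta)) != 0 by rewrite yx (pq_sinh hpq).
  have := expoly_partial_fraction_extra xiD (K_expoly j) yt xt yx0.
  rewrite -/(d_fun xi (p k + eta)) -/(d_fun xi (q j + eta)) -!a_funE yx => pf.
  have -> : \sum_m X j m * (tauP (xi m) / csinh (xi m - p k - eta)) =
      - \sum_m K j (xi m) / (csinh (xi m - (q j + eta)) *
        (\prod_(l | l != m) csinh (xi m - xi l)) * csinh (p k + eta - xi m)).
    rewrite -sumrN; apply: eq_bigr => m _; rewrite mxE -/(dxi xi m).
    have -> : p k + eta - xi m = - (xi m - p k - eta) by ring.
    have q0 : csinh (xi m - (q j + eta)) != 0 by rewrite opprD addrA.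
    have := F_K j m; have := d0 m; have := pe m k; rewrite [csinh (- _)]csinhN.
    have := TQ_tau_neq0 heta hXi TQQ hQden m.
    move: (dxi xi m) (csinh (xi m - p k - eta)) (csinh (xi m - (q j + eta))) q0.
    move: (tauP _) (tauQ _) (F _ _) (K _ _) => tp tq f kk e s t t0 tq0 s0 e0 E.
    have -> : kk = - (f * (tp / tq) * t) by rewrite E opprK.
    by field; rewrite t0 tq0 s0 e0.
  (* At the additional pole the half-argument sinh is 0 and cosh is 1: only the first product
     remains, which explains the 2 and the [P (q_j + i pi)] of [S_mx]. *)
  have Kq : K j (q j + eta) = 2 * (Q (q j + eta) * P (q j + ipi)).
    rewrite /K; have -> : q j + eta - eta + ipi = q j + ipi by ring.
    have -> : q j + eta - q j - eta = 0 by ring.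
    rewrite mul0r csinh0 ccoshE cexp0 invr1; move: (Q _ * _) (Q _ * _) => a b.
    by field.
  (* Here [P (p k) = 0] removes the second product, and [2 cosh^2] of the half argument over
     [sinh(p_k - q_j)] is the half-argument coth. *)
  have Kp : K j (p k + eta) = 2 * (Q (p k + eta) * P (p k + ipi) *
      ccosh ((p k - q j) / 2) ^+ 2).
    rewrite /K; have -> : p k + eta - eta + ipi = p k + ipi by ring.
    have -> : p k + eta - eta = p k by ring.
    have -> : p k + eta - q j - eta = p k - q j by ring.
    by rewrite [P (p k)]tpoly_root mulr0 mul0r subr0.
  move: pf; rewrite Kp Kq; move: (\sum_m _) => Sg pf.
  have -> : Sg = 2 * (Q (p k + eta) * P (p k + ipi) * ccosh ((p k - q j) / 2) ^+ 2) /
      (csinh (p k - q j) * a_fun eta xi (p k)) -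
      2 * (Q (q j + eta) * P (q j + ipi)) / (a_fun eta xi (q j) * csinh (p k - q j)).
    by rewrite pf addrAC subrr add0r.
  have s0 := pq_coth hpq j k.
  have c0 : ccosh ((p k - q j) / 2) != 0.
    by apply: contraNneq (pq_sinh hpq j k) => c0; rewrite csinh_double c0 mulr0.
  rewrite /frak_a /ccoth [csinh (p k - q j)]csinh_double.
  have := pq_a_p hpq k; have := pq_a_q hpq j; have := dp k.
  have := pq_Q hpq k; have := pq_P_ipi hpq k; rewrite -/P -/Q.
  move: (csinh _) (ccosh _) s0 c0 (a_fun eta xi (q j)) (a_fun eta xi (p k)) (d_fun _ _).
  move: (P (p k + ipi)) (P (q j + ipi)) (Q (p k - eta)) (Q (p k + eta)) (Q (q j + eta)).
  move=> P1 P2 Q1 Q2 Q3 sh ch sh0 ch0 aq ap dd P10 Q10 dd0 aq0 ap0.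
  by field; rewrite P10 Q10 sh0 ch0 aq0 ap0 dd0.
have -> : \sum_m X j m * ((m == n)%:R * wrow eta xi n p tauQ k) =
    - (P (p k - eta) / d_fun xi (p k) * P (p k + ipi)) *
    (Q (xi n - eta) / P (xi n - eta) * ccoth ((xi n - q j - eta) / 2) +
     Q (xi n - eta + ipi) / P (xi n - eta + ipi) * ccoth ((xi n + ipi - q j - eta) / 2)).
  rewrite (bigD1 n) //= big1 ?addr0 => [|m /negbTE ->]; last by rewrite mul0r mulr0.
  rewrite eqxx mul1r mxE /F.
  have sw1 : xi n - eta - q j = xi n - q j - eta by ring.
  have sw2 : xi n - eta + ipi - q j = xi n + ipi - q j - eta by ring.
  have -> : Qc j (xi n - eta) = Q (xi n - eta) * ccoth ((xi n - q j - eta) / 2).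
    by rewrite Qc_coth sw1 //; exact: pq_coth_xi hpq j.
  have -> : Qc j (xi n - eta + ipi) =
      Q (xi n - eta + ipi) * ccoth ((xi n + ipi - q j - eta) / 2).
    by rewrite Qc_coth sw2 //; exact: pq_coth_xi_ipi hpq j.
  rewrite /wrow.
  have A0 : A n != 0 by exact: a_fun_xi_neq0.
  have := TQ_xi TQP n; have := TQ_xi_ipi TQP n; rewrite -/P -/Q -/(A n).
  have := TQ_tau_neq0 heta hXi TQP hPden n; have := TQ_tau_neq0 heta hXi TQQ hQden n.
  have := TQ_tpoly_neq0 heta hXi TQP hPden n.
  have := tpoly_ipi_neq0 heta hXi TQP (pq_a_p hpq) n.
  have := dp k; have := d0 n; rewrite -/P.
  move: (ccoth _) (ccoth _) (dxi xi n) (d_fun _ _) (tauP _) (tauQ _) (A n) A0.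
  move: (P (xi n)) (P (xi n - eta)) (P (xi n + ipi)) (P (xi n - eta + ipi)).
  move: (P (p k - eta)) (P (p k + ipi)) (Q (xi n - eta)) (Q (xi n - eta + ipi)).
  move=> P5 P6 Q1 Q2 P1 P2 P3 P4 c1 c2 e b tp tq a a0 e0 b0 P30 P10 tq0 tp0 E1 E2.
  have -> : P2 = - (tp * P1) / a by rewrite E2 opprK mulrC mulKf.
  have -> : P4 = tp * P3 / a by rewrite E1 mulrC mulKf.
  by field; rewrite e0 b0 P30 P10 tq0 tp0 a0.
have := dp k; have := pq_Q hpq k; have := pq_P_ipi hpq k; rewrite -/P -/Q.
move: (ccoth ((p k - q j - eta) / 2)) (_ + _ * ccoth ((xi n + ipi - _ - _) / 2)).
move: (frak_a _ _ _ _ * _) (2 * _ * _ / csinh (p k - q j)).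
move: (P (p k + ipi)) (P (p k - eta)) (Q (p k - eta)) (d_fun _ _).
move=> P1 P2 Q1 dd x y c br P10 Q10 dd0.
by field; rewrite P10 Q10 dd0.
Qed.

Lemma det_S_coth : \det (S_mx eta xi p q - Pz_mx eta xi p q n) * \det (Y_mx xi p tauQ) =
  \det (coth_mx eta p q) * \det (M_mx eta xi n p tauP tauQ).
Proof.
rewrite S_mx_factor coth_mx_factor !det_mulmx.
by move: (\det X) (\det gam) (\det (Y_mx _ _ _)) (\det (M_mx _ _ _ _ _ _)) => a b c e; ring.
Qed.

Lemma det_Y_mx_neq0_coth : \det (Y_mx xi p tauQ) != 0.
Proof.
have := pq_det hpq; rewrite coth_mx_factor !det_mulmx !mulf_eq0 !negb_or.
by case/andP => /andP[].
Qed.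

End CothForm.

Lemma mxrank_outer (F : fieldType) (m n : nat) (A : 'M[F]_(m, n)) (v : 'I_m -> F)
    (w : 'I_n -> F) : (forall i j, A i j = v i * w j) -> (\rank A <= 1)%N.
Proof.
move=> AE; have -> : A = (\col_i v i) *m (\row_j w j).
  by apply/matrixP => i j; rewrite !mxE big_ord1 !mxE.
exact: leq_trans (mxrankM_maxl _ _) (rank_leq_col _).
Qed.

Theorem proposition4p4 (R : realType) (N : nat) (hN : (1 <= N)%N)
  (eta : R[i]) (heta : ~ commensurate eta ipi)
  (xi : 'I_N -> R[i])
  (hXi : forall i j : 'I_N, i != j -> Xi eta xi i `&` Xi eta xi j = set0)
  (bra : config N -> 'rV[R[i]]_#|config N|)
  (ket : config N -> 'cV[R[i]]_#|config N|)
  (hbases : SoV_bases eta xi bra ket)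
  (kappa : R[i]) (hkappa : kappa != 0)
  (eps : R[i]) (heps : eps = 1 \/ eps = -1)
  (n : 'I_N)
  (p q : 'I_N -> R[i]) (tauP tauQ : R[i] -> R[i])
  (hPden : forall m, tpoly p (xi m - eta) != 0)
  (hQden : forall m, tpoly q (xi m - eta) != 0)
  (hP : left_eigenstate eta xi bra p tauP kappa eps)
  (hQ : right_eigenstate eta xi ket q tauQ kappa eps) :
  let form_factor :=
    pairing (left_sep eta xi bra (tpoly p) kappa eps)
            (sigma_z n *m right_sep eta xi ket (tpoly q) kappa eps) in
  (regular_pq eta xi p q tauQ n ->
     form_factor =
       - (\prod_(k < N | (k <= n)%N) (tauP (xi k) / tauQ (xi k)))
         * (\det (S_mx eta xi p q - Pz_mx eta xi p q n)
              / \det (coth_mx eta p q))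
     /\ (\rank (Pz_mx eta xi p q n) <= 1)%N)
  /\
  (forall z : 'I_N -> R[i], regular_z eta xi p z tauQ n ->
     form_factor =
       - ((\prod_(i < N) \prod_(j < N)
             (csinh (z i - xi j) * csinh (xi j - p i)))
          / (cexp (\sum_(l < N) xi l) * (\prod_(j < N) tauQ (xi j))
             * \prod_(i < N) \prod_(j < N | (i < j)%N)
                 (csinh (z j - z i) * csinh (p i - p j))))
         * (\prod_(k < N | (k <= n)%N) (tauP (xi k) / tauQ (xi k)))
         * \det (S_tau_mx eta xi p z tauP tauQ
                   + Pz_tau_mx eta xi p z tauQ n)
     /\ (\rank (Pz_tau_mx eta xi p z tauQ n) <= 1)%N).
Proof.
destruct N as [|d]; first by [].
have xiD i j : i != j -> csinh (xi i - xi j) != 0 by move=> /(Xi_csinh hXi)[].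
have ffE := form_factor_det heta hXi hbases hkappa heps n hPden hQden hP hQ.
split=> [hpq|z hz].
- split; last first.
    apply: (mxrank_outer (v := fun j => tpoly q (xi n - eta) / tpoly p (xi n - eta)
        * ccoth ((xi n - q j - eta) / 2)
      + tpoly q (xi n - eta + ipi) / tpoly p (xi n - eta + ipi)
        * ccoth ((xi n + ipi - q j - eta) / 2))
      (w := fun k => tpoly p (p k - eta) / tpoly q (p k - eta))) => j k.
    by rewrite mxE [RHS]mulrC.
  have hx m k : csinh (xi m - p k) != 0.
    by apply: (regular_root heta hXi hP.1) => // l; apply: pq_a_p hpq l.
  have hxe m k : csinh (xi m - p k - eta) != 0.
    by apply: regular_root_eta => l; apply: pq_a_p hpq l.
  have Y0 := det_Y_mx_neq0_coth heta hXi hPden hQden hP.1 hQ.1 hpq.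
  have := det_S_coth heta hXi hPden hQden hP.1 hQ.1 hpq; have := pq_det hpq.
  have := ffE hx hxe.
  move: (pairing _ _) (\prod_(k < _ | (k <= n)%N) _) Y0.
  move: (\det (Y_mx _ _ _)) (\det (M_mx _ _ _ _ _ _)) (\det (coth_mx _ _ _)) (\det (_ - _)).
  move=> y m c s f pr y0 fE c0 sE.
  apply: (mulIf y0); rewrite fE.
  transitivity (- pr * (c * m) / c); first by field.
  by rewrite -sE; field.
- split; last first.
    apply: (mxrank_outer (v := fun i => (csinh (z i - xi n))^-1)
      (w := fun l => cexp (xi n) * tauQ (xi n) / d_fun xi (p l) *
        (tpoly p (p l - eta) / tpoly p (xi n - eta)) *
        (tpoly p (p l + ipi) / tpoly p (xi n + ipi)))) => i l.
    by rewrite mxE [(d_fun xi (p l) * _)^-1]invfM; ring.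
  have tPd : expoly 1 d tauP.
    exact: (left_eigen_expoly hbases heps hP.2).
  have tQd : expoly 1 d tauQ.
    exact: (right_eigen_expoly hbases heps hQ.2).
  have Y0 := det_Y_mx_neq0 xiD hz.
  have := det_S_tau xiD tPd tQd hz; have := ffE (regular_z_xp hz) (regular_z_xpe hz).
  have V0 : \prod_(i < d.+1) \prod_(j < d.+1 | (i < j)%N)
      (csinh (z j - z i) * csinh (p i - p j)) != 0.
    apply/prodf_neq0 => i _; apply/prodf_neq0 => j ij; apply: mulf_neq0.
      exact: z_distinct hz _ _ ij.
    exact: z_p_distinct hz _ _ ij.
  have T0 : \prod_(j < d.+1) tauQ (xi j) != 0.
    by apply/prodf_neq0 => j _; apply: z_tauQ hz j.
  have E0 := cexp_neq0 (\sum_(l < d.+1) xi l); move: E0 T0 V0 Y0.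
  move: (cexp _) (\prod_(j < d.+1) tauQ (xi j)) (\prod_(i < d.+1) \prod_(j < d.+1 | _) _).
  move: (\prod_i \prod_j (csinh (z i - xi j) * csinh (xi j - p i))).
  move: (\det (Y_mx _ _ _)) (\det (M_mx _ _ _ _ _ _)) (\det (_ + _)).
  move: (pairing _ _) (\prod_(k < _ | _) _).
  move=> f pr y m s a e t v e0 t0 v0 y0 fE sE.
  apply: (mulIf y0); rewrite fE.
  transitivity (- pr * (e * t * v * m) / (e * t * v)); first by field; rewrite e0 t0 v0.
  by rewrite -sE; field; rewrite e0 t0 v0.
Qed.
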